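(* Let $\gamma:(\mathbb{C},0)\to(\mathbb{C}^2,0)$ be an $\mathcal{A}$-finite germ of a parametrised curve, with image $C_\gamma$. (1) There is a unique osculating complex circle or line, that is, one with maximal order of contact with $C_\gamma$ at the origin. If $\gamma$ is singular, this order of contact is finite. (The maximal order of contact with a circle is denoted $\lambda(\gamma)$.) (2) If $\gamma(t)=(t^m,at^n+O(n+1))$ with $a\neq0$ and $n>m$, then the order of contact between $C_\gamma$ and its tangent line is $n$, and $I_\gamma=m+n-3$. (3) $V_\gamma=I_\gamma+\lambda(\gamma)-3$. (4) Let $\gamma(t)=(t^m,y(t))$ with $y(t)=at^n+O(n+1)$, $a\neq0$, $n>m$, as in (2). If $n\neq2m$, then $V_\gamma=3m+n-6$. If $n=2m$, then, writing $y(t)=t^{2m}(a_{2m}+y_1(t))$ with $y_1(0)=0$, $$V_\gamma=3m+n+\mathrm{ord}\left(a_{2m}t^{2m}(a_{2m}+y_1(t))^2-y_1(t)\right)-3.$$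
   Context: A germ $\gamma=(x,y):(\mathbb{C},0)\to(\mathbb{C}^2,0)$ is $\mathcal{A}$-finite if and only if it is an injective immersion away from $0$; it is singular if $\gamma'(0)=0$. For a holomorphic function germ $\rho$ in one variable, $\mathrm{ord}(\rho)$ is its order of vanishing at $0$ (possibly $\infty$). $O(k)$ denotes terms of order at least $k$ in $t$. Complex circles and lines through the origin are the curves $A(x^2+y^2)+2Bx+2Cy=0$ with $(A,B,C)\in\mathbb{C}^3\setminus\{0\}$, up to a nonzero scalar; those with $A=0$ are lines (regarded as degenerate circles), those with $A\neq0$ are circles (including $x^2+y^2=0$). The order of contact of $\gamma$ with such a curve at the origin is $\mathrm{ord}\left(A(x(t)^2+y(t)^2)+2Bx(t)+2Cy(t)\right)$. The maximum defining $\lambda(\gamma)$ is over the circles with $A\neq0$. Put $i_\gamma=x'y''-x''y'$, $v_\gamma=(x'^2+y'^2)(x'y'''-x'''y')+3(x'x''+y'y'')(x''y'-x'y'')$, $I_\gamma=\mathrm{ord}(i_\gamma)$ and $V_\gamma=\mathrm{ord}(v_\gamma)$.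
   Formalization: In (1) uniqueness is claimed only for germs not contained in an isotropic line bx+cy=0, b²+c²=0 (it fails for (t,it)); in (4), case n=2m, the constant −3 is corrected to −6 (for (t,t²+t³), V=0 but the printed formula gives 3). *)

(* Defs.v *)
From Stdlib Require Import Reals.
From Coquelicot Require Import Coquelicot.

Set Implicit Arguments.
Unset Strict Implicit.
Unset Printing Implicit Defensive.

Open Scope C_scope.

(* A germ at 0 is represented by a total function; every notion below depends
   only on its values near 0.  Holomorphic germs are the elements of C{t}. *)
Definition holomorphic_germ (f : C -> C) : Prop :=
  exists (a : nat -> C) (r : R), (0 < r)%R /\
    forall t : C, (Cmod t < r)%R ->
      @is_pseries C_AbsRing C_NormedModule a t (f t).

Fixpoint C_derive_n (f : C -> C) (n : nat) : C -> C :=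
  match n with
  | O => f
  | S k => C_derive (C_derive_n f k)
  end.

(* The infimum of the empty set is p_infty, so ord f = p_infty when all the
   derivatives of f vanish at 0. *)
Definition ord (f : C -> C) : Rbar :=
  Glb_Rbar (fun r => exists n : nat, r = INR n /\ C_derive_n f n 0 <> 0).

Definition curve_germ (x y : C -> C) : Prop :=
  holomorphic_germ x /\ holomorphic_germ y /\ x 0 = 0 /\ y 0 = 0.

Definition A_finite (x y : C -> C) : Prop :=
  exists r : R, (0 < r)%R /\
    (forall s t : C, (0 < Cmod s < r)%R -> (0 < Cmod t < r)%R ->
       x s = x t -> y s = y t -> s = t) /\
    (forall t : C, (0 < Cmod t < r)%R ->
       ~ (C_derive x t = 0 /\ C_derive y t = 0)).

Definition singular_germ (x y : C -> C) : Prop :=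
  C_derive x 0 = 0 /\ C_derive y 0 = 0.

(* The curve cA (x^2 + y^2) + 2 cB x + 2 cC y = 0, up to same_curve. *)
Record circle_or_line := CircleOrLine {
  cA : C;
  cB : C;
  cC : C;
  c_nonzero : ~ (cA = 0 /\ cB = 0 /\ cC = 0)
}.

Definition same_curve (G H : circle_or_line) : Prop :=
  exists k : C, k <> 0 /\
    cA H = k * cA G /\ cB H = k * cB G /\ cC H = k * cC G.

Definition is_line (G : circle_or_line) : Prop := cA G = 0.

Definition is_circle (G : circle_or_line) : Prop := cA G <> 0.

Definition contact (x y : C -> C) (G : circle_or_line) : Rbar :=
  ord (fun t => cA G * (x t ^ 2 + y t ^ 2) + 2 * cB G * x t + 2 * cC G * y t).

Definition osculating (x y : C -> C) (G : circle_or_line) : Prop :=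
  forall H : circle_or_line, Rbar_le (contact x y H) (contact x y G).

(* l = lambda(x, y), the maximum being over the circles only. *)
Definition is_lambda (x y : C -> C) (l : Rbar) : Prop :=
  (exists G, is_circle G /\ contact x y G = l) /\
  (forall G, is_circle G -> Rbar_le (contact x y G) l).

(* For a possibly singular germ the tangent line at 0 is the limit of the
   tangent lines at the parameters t <> 0: the linear form defining it, applied
   to the normalised velocity, tends to 0. *)
Definition is_tangent_line (x y : C -> C) (G : circle_or_line) : Prop :=
  is_line G /\
  filterlim
    (fun t : C =>
       (Cmod (cB G * C_derive x t + cC G * C_derive y t)%C /
        (Cmod (C_derive x t) + Cmod (C_derive y t)))%R)
    (locally' (0 : C)) (locally 0%R).

(* A regular germ lying on an isotropic line has contact of infinite order with
   that line and also with every reducible circle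
   (x + i y) (A (x - i y) + 2 B) = 0 containing it. *)
Definition in_isotropic_line (x y : C -> C) : Prop :=
  exists b c : C, ~ (b = 0 /\ c = 0) /\ b ^ 2 + c ^ 2 = 0 /\
    locally (0 : C) (fun t => b * x t + c * y t = 0).

Definition i_germ (x y : C -> C) (t : C) : C :=
  C_derive_n x 1 t * C_derive_n y 2 t - C_derive_n x 2 t * C_derive_n y 1 t.

Definition v_germ (x y : C -> C) (t : C) : C :=
  (C_derive_n x 1 t ^ 2 + C_derive_n y 1 t ^ 2) *
  (C_derive_n x 1 t * C_derive_n y 3 t - C_derive_n x 3 t * C_derive_n y 1 t) +
  3 * (C_derive_n x 1 t * C_derive_n x 2 t + C_derive_n y 1 t * C_derive_n y 2 t) *
  (C_derive_n x 2 t * C_derive_n y 1 t - C_derive_n x 1 t * C_derive_n y 2 t).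

Definition I_ord (x y : C -> C) : Rbar := ord (i_germ x y).

Definition V_ord (x y : C -> C) : Rbar := ord (v_germ x y).

(* (x, y) = (t^m, a t^n + O(n + 1)) with a <> 0 and n > m. *)
Definition normal_form (x y : C -> C) (m n : nat) (a : C) : Prop :=
  (0 < m < n)%nat /\ a <> 0 /\
  locally (0 : C) (fun t => x t = t ^ m) /\
  Rbar_le (INR (n + 1)) (ord (fun t => y t - a * t ^ n)).

(* y = t^{2m} (a + y1) with y1(0) = 0. *)
Definition second_factor (y : C -> C) (m : nat) (a : C) (y1 : C -> C) : Prop :=
  holomorphic_germ y1 /\ y1 0 = 0 /\
  locally (0 : C) (fun t => y t = t ^ (2 * m) * (a + y1 t)).

(* Main.v *)
Require Import Defs.
From Stdlib Require Import Reals Lra Lia Psatz Classical.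
From Coquelicot Require Import Coquelicot.

(** Put u = x^2 + y^2.  Subtracting x (x', x'', x''') and y (y', y'', y''') from half
    of (u', u'', u''') shows that v is -1/2 times the Wronskian of x', y', u', while i
    is the Wronskian of x', y'.  Both Wronskians are multiplied by a nonzero constant
    under a change of basis of <x, y> and <x, y, u>.  In bases with distinct orders
    e1 < e2 (of <x, y>) and e1, e2, e3 (of <x, y, u>) the Wronskians have orders
    e1 + e2 - 3 and e1 + e2 + e3 - 6, by a Vandermonde determinant, and e3 is the
    largest order in the coset u + <x, y>, that is, lambda.  Two osculating circles
    with the same finite contact would combine into one of higher contact; with
    infinite contact they force the curve into an isotropic line.  Finally, a singular
    germ contained in a circle or line is parametrised by a function with a critical
    point, which is never injective. *)

Set Implicit Arguments.
Unset Strict Implicit.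
Unset Printing Implicit Defensive.
Open Scope C_scope.

(** The equation of a circle or line is linear in x, y and u, so contact orders are orders of
    elements in the span of three germs, and Gaussian elimination on leading terms yields the
    adapted bases for an arbitrary parametrisation. The losses 3 = 1 + 2 and 6 = 1 + 2 + 3 count the
    differentiations in each product of the determinants. The obstacle is infinite order: x and y
    may be proportional, or the curve may lie on a circle. The third basis element is therefore only
    made to differ in order from the other two or to have infinite order; as soon as some order is
    infinite, both sides of (3) are. Circles and lines are maximised separately: [is_lambda] ranges
    over A <> 0, while an osculating curve may be a line. For non-injectivity at a critical point, a
    Newton iteration with explicit estimates takes the place of Rouche's theorem or of a local m-th
    root. *)

Lemma locally_at_iff (z : C) (P : C -> Prop) :
  locally z P <-> exists r : R, (0 < r)%R /\ forall h, (Cmod h < r)%R -> P (z + h).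
Proof.
  assert (E1 : forall t : C, z + t - z = t) by (intros; ring).
  assert (E2 : forall t : C, z + (t - z) = t) by (intros; ring).
  split.
  - intros H. apply locally_C in H. destruct H as [r Hr].
    exists r; split; [apply cond_pos|]. intros t Ht. apply Hr.
    change (Cmod (z + t - z) < r)%R. now rewrite E1.
  - intros [r [r0 H]]. apply locally_C. exists (mkposreal r r0). intros t Ht.
    rewrite <- (E2 t). apply H. exact Ht.
Qed.

Lemma locally_0_iff (P : C -> Prop) :
  locally (0 : C) P <-> exists r : R, (0 < r)%R /\ forall t, (Cmod t < r)%R -> P t.
Proof.
  rewrite locally_at_iff.
  split; intros [r [r0 H]]; exists r; split; auto; intros t Ht; specialize (H t Ht);
    now rewrite Cplus_0_l in *.
Qed.

(** Differentiability as a bound on the first-order remainder: h = 0 is included and nothing is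
    divided, so sums and products reduce to the triangle inequality. *)
Definition cdiff (f : C -> C) (z l : C) : Prop :=
  forall e : R, (0 < e)%R -> exists d : R, (0 < d)%R /\
    forall h, (Cmod h < d)%R -> (Cmod (f (z + h)%C - f z - l * h) <= e * Cmod h)%R.

Lemma cdiff_is_derive (f : C -> C) (z l : C) :
  cdiff f z l -> @is_derive C_AbsRing C_NormedModule f z l.
Proof.
  intros H. split.
  - apply is_linear_scal_l.
  - intros w Hw.
    apply (@is_filter_lim_locally_unique _ (AbsRing_NormedModule C_AbsRing)) in Hw.
    rewrite <- Hw. clear w Hw.
    intros eps. destruct (H eps (cond_pos eps)) as [d [d0 Hd]].
    exists (mkposreal d d0). intros w Hw.
    change (Cmod (w - z) < d)%R in Hw.
    specialize (Hd _ Hw).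
    assert (E : forall t : C, z + (t - z) = t) by (intros; ring).
    rewrite E in Hd.
    rewrite Cmult_comm in Hd. exact Hd.
Qed.

Lemma cdiff_derive (f : C -> C) (z l : C) : cdiff f z l -> C_derive f z = l.
Proof. intros H. now apply is_C_derive_unique, cdiff_is_derive. Qed.

Lemma cdiff_const (c z : C) : cdiff (fun _ => c) z 0.
Proof.
  intros e He. exists 1%R. split; [lra|]. intros h _.
  replace (c - c - 0 * h) with (0 : C) by ring. rewrite Cmod_0.
  apply Rmult_le_pos; [lra|apply Cmod_ge_0].
Qed.

Lemma cdiff_id (z : C) : cdiff (fun t => t) z 1.
Proof.
  intros e He. exists 1%R. split; [lra|]. intros h _.
  replace (z + h - z - 1 * h) with (0 : C) by ring. rewrite Cmod_0.
  apply Rmult_le_pos; [lra|apply Cmod_ge_0].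
Qed.

Lemma cdiff_ext_loc (f g : C -> C) (z l : C) :
  locally z (fun t => f t = g t) -> cdiff f z l -> cdiff g z l.
Proof.
  intros Hfg H e He. apply locally_at_iff in Hfg. destruct Hfg as [r [r0 Hr]].
  destruct (H e He) as [d [d0 Hd]].
  exists (Rmin r d); split; [now apply Rmin_glb_lt|].
  intros h Hh. rewrite <- (Hr h).
  - replace (g z) with (f z).
    + apply Hd. apply Rlt_le_trans with (1 := Hh), Rmin_r.
    + replace z with (z + 0) by ring. apply Hr. rewrite Cmod_0; lra.
  - apply Rlt_le_trans with (1 := Hh), Rmin_l.
Qed.

Lemma cdiff_plus (f g : C -> C) (z l m : C) :
  cdiff f z l -> cdiff g z m -> cdiff (fun t => f t + g t) z (l + m).
Proof.
  intros Hf Hg e He.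
  destruct (Hf (e / 2)%R) as [d [d0 Hd]]; [lra|].
  destruct (Hg (e / 2)%R) as [d' [d0' Hd']]; [lra|].
  exists (Rmin d d'); split; [now apply Rmin_glb_lt|]. intros h Hh.
  replace (f (z + h) + g (z + h) - (f z + g z) - (l + m) * h)
    with ((f (z + h) - f z - l * h) + (g (z + h) - g z - m * h)) by ring.
  eapply Rle_trans; [apply Cmod_triangle|].
  assert (H1 := Hd h (Rlt_le_trans _ _ _ Hh (Rmin_l _ _))).
  assert (H2 := Hd' h (Rlt_le_trans _ _ _ Hh (Rmin_r _ _))). lra.
Qed.

Lemma cdiff_mult (f g : C -> C) (z l m : C) :
  cdiff f z l -> cdiff g z m ->
  cdiff (fun t => f t * g t) z (l * g z + f z * m).
Proof.
  intros Hf Hg e He.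
  (* The remainder of the product is a sum of three terms, each at most [e1 * Cmod h * K]; hence the
     3 in [e1]. The last term is quadratic in h, which is why |h| < [e1] is imposed as well. *)
  pose (K := ((1 + Cmod (f z) + Cmod l) * (Cmod (g z) + Cmod m + 1))%R).
  assert (P1 := Cmod_ge_0 (f z)). assert (P2 := Cmod_ge_0 l).
  assert (P3 := Cmod_ge_0 (g z)). assert (P4 := Cmod_ge_0 m).
  assert (HK : (1 <= K)%R) by (unfold K; nra).
  pose (e1 := Rmin 1 (e / (3 * K))).
  assert (He1 : (0 < e1)%R).
  { apply Rmin_glb_lt; [lra|]. apply Rdiv_lt_0_compat; lra. }
  assert (He1' : (e1 * (3 * K) <= e)%R).
  { apply Rle_trans with (e / (3 * K) * (3 * K))%R; [|right; field; lra].
    apply Rmult_le_compat_r; [lra|]. apply Rmin_r. }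
  assert (He11 : (e1 <= 1)%R) by apply Rmin_l.
  clearbody e1.
  destruct (Hf e1 He1) as [d [d0 Hd]]. destruct (Hg e1 He1) as [d' [d0' Hd']].
  exists (Rmin (Rmin d d') e1); split; [repeat apply Rmin_glb_lt; lra|].
  intros h Hh.
  assert (Hhd : (Cmod h < d)%R).
  { eapply Rlt_le_trans; [exact Hh|]. eapply Rle_trans; [apply Rmin_l|apply Rmin_l]. }
  assert (Hhd' : (Cmod h < d')%R).
  { eapply Rlt_le_trans; [exact Hh|]. eapply Rle_trans; [apply Rmin_l|apply Rmin_r]. }
  assert (Hhe : (Cmod h < e1)%R) by (eapply Rlt_le_trans; [exact Hh|apply Rmin_r]).
  specialize (Hd h Hhd). specialize (Hd' h Hhd').
  assert (Hh0 := Cmod_ge_0 h).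
  set (D := f (z + h) - f z - l * h) in *. set (E := g (z + h) - g z - m * h) in *.
  replace (f (z + h) * g (z + h) - f z * g z - (l * g z + f z * m) * h)
    with (f z * E + D * (g z + m * h + E) + l * h * (m * h + E)) by (unfold D, E; ring).
  assert (HE : (Cmod E <= Cmod h)%R) by nra.
  assert (HmE : (Cmod (m * h + E) <= (Cmod m + 1) * Cmod h)%R).
  { eapply Rle_trans; [apply Cmod_triangle|]. rewrite Cmod_mult. lra. }
  assert (HgE : (Cmod (g z + m * h + E) <= K)%R).
  { replace (g z + m * h + E) with (g z + (m * h + E)) by ring.
    eapply Rle_trans; [apply Cmod_triangle|]. unfold K. nra. }
  eapply Rle_trans; [apply Cmod_triangle|].
  apply Rle_trans with (e1 * Cmod h * K + e1 * Cmod h * K + e1 * Cmod h * K)%R; [|nra].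
  apply Rplus_le_compat; [eapply Rle_trans; [apply Cmod_triangle|];
    apply Rplus_le_compat|]; rewrite ?Cmod_mult.
  - rewrite Rmult_comm. apply Rmult_le_compat; try apply Cmod_ge_0; auto.
    unfold K; nra.
  - apply Rmult_le_compat; auto using Cmod_ge_0.
  - replace (e1 * Cmod h * K)%R with (Cmod h * (e1 * K))%R by ring.
    replace (Cmod l * Cmod h * Cmod (m * h + E))%R
      with (Cmod h * (Cmod (m * h + E) * Cmod l))%R by ring.
    apply Rmult_le_compat_l; auto.
    apply Rle_trans with (e1 * (Cmod m + 1) * Cmod l)%R.
    + apply Rmult_le_compat_r; auto. nra.
    + unfold K. rewrite Rmult_assoc. apply Rmult_le_compat_l; [lra|]. nra.
Qed.

(** * Complex power series *)

Definition C_series (u : nat -> C) (l : C) : Prop :=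
  @is_series C_AbsRing C_NormedModule u l.

Lemma C_series_bound (u : nat -> C) (b : nat -> R) (l : C) (B : R) :
  C_series u l -> is_series b B -> (forall n, (Cmod (u n) <= b n)%R) ->
  (Cmod l <= B)%R.
Proof.
  intros Hu Hb H.
  assert (Hs : forall n, (norm (sum_n u n : C_NormedModule) <= sum_n b n)%R).
  { intros n. eapply Rle_trans; [apply (@norm_sum_n_m C_AbsRing C_NormedModule)|].
    apply sum_n_m_le. intros k. exact (H k). }
  assert (Hl : is_lim_seq (fun n => norm (sum_n u n : C_NormedModule)) (Cmod l)).
  { eapply filterlim_comp; [exact Hu|]. apply (@filterlim_norm C_AbsRing C_NormedModule l). }
  exact (is_lim_seq_le _ _ (Finite (Cmod l)) (Finite B) Hs Hl Hb).
Qed.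

Lemma C_series_terms_bounded (u : nat -> C) (l : C) :
  C_series u l -> exists M : R, forall n, (Cmod (u n) <= M)%R.
Proof.
  intros Hu.
  destruct (@filterlim_bounded C_AbsRing C_NormedModule (sum_n u) (ex_intro _ l Hu))
    as [M HM].
  exists (2 * M)%R. intros n.
  assert (HM' : forall k, (Cmod (sum_n u k) <= M)%R) by exact HM.
  destruct n as [|n].
  - assert (H := HM' O). rewrite sum_O in H. assert (H' := Cmod_ge_0 (u O)). lra.
  - replace (u (S n)) with (sum_n u (S n) + - (sum_n u n)).
    + eapply Rle_trans; [apply Cmod_triangle|]. rewrite Cmod_opp.
      assert (H1 := HM' (S n)). assert (H2 := HM' n). lra.
    + rewrite sum_Sn. change (sum_n u n + u (S n) + - sum_n u n = u (S n)). ring.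
Qed.

Lemma C_series_ext (u v : nat -> C) (l : C) :
  (forall n, u n = v n) -> C_series u l -> C_series v l.
Proof. intros H. now apply (@is_series_ext C_AbsRing C_NormedModule). Qed.

Lemma C_series_eq (u : nat -> C) (l m : C) : C_series u l -> l = m -> C_series u m.
Proof. now intros H <-. Qed.

Lemma C_series_plus (u v : nat -> C) (l m : C) :
  C_series u l -> C_series v m -> C_series (fun n => u n + v n) (l + m).
Proof. exact (is_series_plus u v l m). Qed.

Lemma C_series_scal (c : C) (u : nat -> C) (l : C) :
  C_series u l -> C_series (fun n => c * u n) (c * l).
Proof. exact (is_series_scal c u l). Qed.

Lemma C_series_tail (u : nat -> C) (l : C) :
  C_series u l -> C_series (fun n => u (S n)) (l - u O).
Proof.
  intros H. apply (@is_series_incr_1 C_AbsRing C_NormedModule u).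
  change (C_series u (l - u O + u O)). now replace (l - u O + u O) with l by ring.
Qed.

Lemma C_series_cons (u : nat -> C) (l : C) :
  C_series (fun n => u (S n)) l -> C_series u (l + u O).
Proof.
  intros H. apply (@is_series_decr_1 C_AbsRing C_NormedModule u).
  change (C_series (fun k => u (S k)) (l + u O + - u O)).
  now replace (l + u O + - u O) with l by ring.
Qed.

Lemma C_series_unique (u : nat -> C) (l m : C) :
  C_series u l -> C_series u m -> l = m.
Proof. intros H1 H2. exact (filterlim_locally_unique _ _ _ H1 H2). Qed.

Lemma C_series_of_abs (u : nat -> C) (b : nat -> R) :
  (forall n, (Cmod (u n) <= b n)%R) -> ex_series b -> exists l, C_series u l.
Proof.
  intros H Hb. apply (@ex_series_le C_AbsRing C_CompleteNormedModule u b); auto.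
Qed.

Definition pow_series (a : nat -> C) (r : R) (f : C -> C) : Prop :=
  forall t : C, (Cmod t < r)%R -> C_series (fun n => a n * t ^ n) (f t).

Lemma pow_n_Cpow (t : C) (n : nat) : @pow_n C_Ring t n = t ^ n.
Proof. induction n as [|n IH]; simpl; [reflexivity|]. now rewrite IH. Qed.

Lemma holomorphic_germ_iff (f : C -> C) :
  holomorphic_germ f <-> exists a r, (0 < r)%R /\ pow_series a r f.
Proof.
  split; intros [a [r [r0 H]]]; exists a, r; split; auto; intros t Ht;
    specialize (H t Ht).
  - eapply C_series_ext; [|exact H]. intros n. rewrite pow_n_Cpow. apply Cmult_comm.
  - eapply C_series_ext; [|exact H]. intros n. rewrite pow_n_Cpow. apply Cmult_comm.
Qed.

(** Stated through the real series of moduli, so that the theory of [CV_radius], in particular its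
    invariance under [PS_derive], serves complex coefficients. *)
Definition abs_conv (a : nat -> C) (r : R) : Prop :=
  Rbar_le r (CV_radius (fun n => Cmod (a n))).

(** Abel's argument: convergence at a real point s < r bounds the terms |a_n| s^n, so the radius is
    at least s, for every such s. *)
Lemma pow_series_abs_conv (a : nat -> C) (r : R) (f : C -> C) :
  pow_series a r f -> abs_conv a r.
Proof.
  intros H. unfold abs_conv.
  destruct (CV_radius_bounded (fun n => Cmod (a n))) as [Hub _].
  assert (Hs : forall s : R, (0 <= s < r)%R -> Rbar_le s (CV_radius (fun n => Cmod (a n)))).
  { intros s [s0 Hs]. apply Hub.
    assert (Hc : (Cmod s < r)%R) by (rewrite Cmod_R, Rabs_pos_eq; lra).
    destruct (C_series_terms_bounded (H s Hc)) as [M HM].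
    exists M. intros n. specialize (HM n).
    rewrite Cmod_mult, Cmod_pow, Cmod_R, (Rabs_pos_eq s) in HM by lra.
    rewrite Rabs_pos_eq; auto.
    apply Rmult_le_pos; [apply Cmod_ge_0|now apply pow_le]. }
  destruct (CV_radius (fun n => Cmod (a n))) as [R0| |] eqn:E; simpl in *; auto.
  - destruct (Rle_or_lt r R0) as [|Hlt]; auto.
    assert (E0 := CV_radius_ge_0 (fun n => Cmod (a n))). rewrite E in E0. simpl in E0.
    assert (h := Hs ((R0 + r) / 2)%R). lra.
  - assert (E0 := CV_radius_ge_0 (fun n => Cmod (a n))). rewrite E in E0. exact E0.
Qed.

Lemma abs_conv_series (a : nat -> C) (r s : R) :
  abs_conv a r -> (0 <= s < r)%R -> ex_series (fun n => Cmod (a n) * s ^ n)%R.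
Proof.
  intros H [s0 Hs].
  assert (Hd : Rbar_lt (Rabs s) (CV_radius (fun n => Cmod (a n)))).
  { rewrite Rabs_pos_eq by lra. eapply Rbar_lt_le_trans; [|exact H]. exact Hs. }
  apply CV_disk_inside in Hd. eapply ex_series_ext; [|exact Hd].
  intros n. simpl. rewrite Rabs_pos_eq; auto.
  apply Rmult_le_pos; [apply Cmod_ge_0|now apply pow_le].
Qed.

Definition dcoef (a : nat -> C) (n : nat) : C := RtoC (INR (S n)) * a (S n).

Lemma dcoef_abs_conv (a : nat -> C) (r : R) : abs_conv a r -> abs_conv (dcoef a) r.
Proof.
  intros H. unfold abs_conv in *. rewrite <- CV_radius_derive in H.
  erewrite CV_radius_ext; [exact H|]. intros n.
  unfold PS_derive, dcoef. rewrite Cmod_mult, Cmod_R, Rabs_pos_eq; auto. apply pos_INR.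
Qed.

Lemma abs_conv_pow_series (a : nat -> C) (r : R) :
  abs_conv a r -> forall t, (Cmod t < r)%R -> exists l, C_series (fun n => a n * t ^ n) l.
Proof.
  intros H t Ht. apply C_series_of_abs with (fun n => Cmod (a n) * Cmod t ^ n)%R.
  - intros n. rewrite Cmod_mult, Cmod_pow. lra.
  - apply abs_conv_series with r; auto. split; [apply Cmod_ge_0|auto].
Qed.

Lemma pow_lipschitz (a b : C) (s : R) (n : nat) :
  (Cmod a <= s)%R -> (Cmod b <= s)%R ->
  (Cmod (a ^ S n - b ^ S n)%C <= INR (S n) * s ^ n * Cmod (a - b)%C)%R.
Proof.
  intros Ha Hb. assert (Hs : (0 <= s)%R) by (eapply Rle_trans; [apply Cmod_ge_0|eauto]).
  induction n as [|n IH].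
  - replace (a ^ 1 - b ^ 1) with (a - b) by ring. simpl. lra.
  - replace (a ^ S (S n) - b ^ S (S n))
      with (a * (a ^ S n - b ^ S n) + (a - b) * b ^ S n) by (simpl; ring).
    eapply Rle_trans; [apply Cmod_triangle|]. rewrite !Cmod_mult, Cmod_pow.
    assert (P : (Cmod b ^ S n <= s ^ S n)%R) by (apply pow_incr; split; [apply Cmod_ge_0|auto]).
    apply Rle_trans with (s * (INR (S n) * s ^ n * Cmod (a - b)%C) + Cmod (a - b)%C * s ^ S n)%R.
    + apply Rplus_le_compat.
      * apply Rmult_le_compat; auto using Cmod_ge_0.
      * apply Rmult_le_compat_l; auto using Cmod_ge_0.
    + rewrite (S_INR (S n)). simpl pow. right; ring.
Qed.

(** The factor (n + 2)(n + 1) s^n is the one carried by [dcoef (dcoef a)], so these bounds sum to a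
    convergent series when multiplied by the coefficients. *)
Lemma pow_remainder (t h : C) (s : R) (n : nat) :
  (Cmod t <= s)%R -> (Cmod (t + h)%C <= s)%R ->
  (Cmod ((t + h) ^ S (S n) - t ^ S (S n) - RtoC (INR (S (S n))) * t ^ S n * h)
    <= INR (S (S n)) * INR (S n) * s ^ n * Cmod h ^ 2)%R.
Proof.
  intros Ht Hh. assert (Hs : (0 <= s)%R) by (eapply Rle_trans; [apply Cmod_ge_0|eauto]).
  assert (H1 : forall m, (Cmod ((t + h) ^ S m - t ^ S m)%C <= INR (S m) * s ^ m * Cmod h)%R).
  { intros m. eapply Rle_trans; [apply pow_lipschitz; eauto|].
    right. do 2 f_equal. ring. }
  induction n as [|n IH].
  - replace ((t + h) ^ 2 - t ^ 2 - RtoC (INR 2) * t ^ 1 * h) with (h ^ 2).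
    + rewrite Cmod_pow. simpl. assert (Q := Cmod_ge_0 h). nra.
    + simpl. rewrite RtoC_plus. ring.
  - replace ((t + h) ^ S (S (S n)) - t ^ S (S (S n)) - RtoC (INR (S (S (S n)))) * t ^ S (S n) * h)
      with (t * ((t + h) ^ S (S n) - t ^ S (S n) - RtoC (INR (S (S n))) * t ^ S n * h)
            + h * ((t + h) ^ S (S n) - t ^ S (S n))).
    + eapply Rle_trans; [apply Cmod_triangle|]. rewrite !Cmod_mult.
      assert (Q := Cmod_ge_0 h).
      apply Rle_trans with (s * (INR (S (S n)) * INR (S n) * s ^ n * Cmod h ^ 2)
                             + Cmod h * (INR (S (S n)) * s ^ S n * Cmod h))%R.
      * apply Rplus_le_compat.
        -- apply Rmult_le_compat; auto using Cmod_ge_0.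
        -- apply Rmult_le_compat_l; auto.
      * assert (P : (0 <= s ^ S n * Cmod h ^ 2)%R).
        { apply Rmult_le_pos; apply pow_le; auto. }
        replace (s * (INR (S (S n)) * INR (S n) * s ^ n * Cmod h ^ 2)
                  + Cmod h * (INR (S (S n)) * s ^ S n * Cmod h))%R
          with (INR (S (S n)) * (INR (S n) + 1) * (s ^ S n * Cmod h ^ 2))%R by (simpl pow; ring).
        replace (INR (S (S (S n))) * INR (S (S n)) * s ^ S n * Cmod h ^ 2)%R
          with (INR (S (S n)) * INR (S (S (S n))) * (s ^ S n * Cmod h ^ 2))%R by ring.
        apply Rmult_le_compat_r; auto. apply Rmult_le_compat_l; [apply pos_INR|].
        rewrite (S_INR (S (S n))), (S_INR (S n)). lra.
    + rewrite (S_INR (S (S n))), RtoC_plus. simpl Cpow. ring.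
Qed.

Lemma pow_series_cdiff (a : nat -> C) (r : R) (f : C -> C) (t l : C) :
  pow_series a r f -> (Cmod t < r)%R ->
  C_series (fun n => dcoef a n * t ^ n) l -> cdiff f t l.
Proof.
  intros Hf Ht Hl.
  assert (Ha := pow_series_abs_conv Hf).
  assert (Hdd := dcoef_abs_conv (dcoef_abs_conv Ha)).
  pose (s := ((Cmod t + r) / 2)%R). assert (T0 := Cmod_ge_0 t).
  assert (Hs : (0 <= s < r)%R) by (unfold s; lra).
  destruct (abs_conv_series Hdd Hs) as [B HB].
  assert (HB0 : (0 <= B)%R).
  { eapply Rle_trans; [|apply (is_lim_seq_incr_compare _ _ HB)  with (n := O)].
    - rewrite sum_O. simpl. rewrite Rmult_1_r. apply Cmod_ge_0.
    - intros n. rewrite sum_Sn. change plus with Rplus.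
      assert (0 <= Cmod (dcoef (dcoef a) (S n)) * s ^ S n)%R; [|simpl in *; lra].
      apply Rmult_le_pos; [apply Cmod_ge_0|apply pow_le; lra]. }
  intros e He. exists (Rmin (s - Cmod t) (e / (B + 1))).
  assert (He' : (0 < e / (B + 1))%R) by (apply Rdiv_lt_0_compat; lra).
  split. { apply Rmin_glb_lt; auto. unfold s; lra. }
  intros h Hh.
  assert (h1 : (Cmod h < s - Cmod t)%R) by (eapply Rlt_le_trans; [exact Hh|apply Rmin_l]).
  assert (h2 : (Cmod h < e / (B + 1))%R) by (eapply Rlt_le_trans; [exact Hh|apply Rmin_r]).
  assert (Hts : (Cmod (t + h)%C <= s)%R) by (eapply Rle_trans; [apply Cmod_triangle|lra]).
  (* After subtraction of the series at t and of h times the derived series, the terms of index 0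
     and 1 cancel; the others are bounded term by term by |h|^2 times the series with sum [B]. *)
  assert (H0 : C_series (fun n => a n * (t + h) ^ n + -1 * (a n * t ^ n))
                 (f (t + h) + -1 * f t)).
  { apply C_series_plus; [apply Hf; lra|]. now apply C_series_scal, Hf. }
  apply C_series_tail in H0.
  assert (H1 := C_series_plus H0 (C_series_scal (c := - h) Hl)).
  apply C_series_tail in H1.
  assert (HB' : is_series (fun n => Cmod h ^ 2 * (Cmod (dcoef (dcoef a) n) * s ^ n))%R
                 (Cmod h ^ 2 * B)%R) by exact (is_series_scal (Cmod h ^ 2)%R _ B HB).
  assert (H2 : (Cmod (f (t + h)%C - f t - l * h) <= Cmod h ^ 2 * B)%R).
  { eapply Rle_trans; [|refine (C_series_bound H1 HB' _)].
    - right. f_equal. unfold dcoef. simpl. ring.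
    - intros n. unfold dcoef.
      replace (a (S (S n)) * (t + h) ^ S (S n) + -1 * (a (S (S n)) * t ^ S (S n))
               + - h * (RtoC (INR (S (S n))) * a (S (S n)) * t ^ S n))
        with (a (S (S n)) * ((t + h) ^ S (S n) - t ^ S (S n)
               - RtoC (INR (S (S n))) * t ^ S n * h)) by ring.
      rewrite !Cmod_mult, !Cmod_R, !(Rabs_pos_eq (INR _)) by apply pos_INR.
      apply Rle_trans with
        (Cmod (a (S (S n))) * (INR (S (S n)) * INR (S n) * s ^ n * Cmod h ^ 2))%R.
      + apply Rmult_le_compat_l; [apply Cmod_ge_0|]. apply pow_remainder; auto.
        unfold s; lra.
      + right; ring. }
  eapply Rle_trans; [exact H2|].
  assert (Hh0 := Cmod_ge_0 h).
  assert (H3 : (Cmod h * (B + 1) <= e)%R).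
  { apply Rle_trans with (e / (B + 1) * (B + 1))%R; [|right; field; lra].
    apply Rmult_le_compat_r; lra. }
  simpl in *. nra.
Qed.

Lemma pow_series_derive (a : nat -> C) (r : R) (f : C -> C) :
  pow_series a r f ->
  pow_series (dcoef a) r (C_derive f) /\
  forall t, (Cmod t < r)%R -> cdiff f t (C_derive f t).
Proof.
  intros Hf. assert (Ha := dcoef_abs_conv (pow_series_abs_conv Hf)).
  split; intros t Ht; destruct (abs_conv_pow_series Ha Ht) as [l Hl];
    assert (H := pow_series_cdiff Hf Ht Hl); rewrite (cdiff_derive H); assumption.
Qed.

Lemma pow_series_at_0 (a : nat -> C) (r : R) (f : C -> C) :
  (0 < r)%R -> pow_series a r f -> f 0 = a O.
Proof.
  intros r0 Hf.
  assert (H : C_series (fun n => a n * 0 ^ n) (f 0)) by (apply Hf; rewrite Cmod_0; auto).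
  refine (C_series_unique H _).
  assert (H0 := C_series_scal (c := 0) (C_series_tail H)).
  replace (a O) with (0 * (f 0 - a O * 0 ^ O) + a O * 0 ^ O) by (simpl; ring).
  apply C_series_cons with (u := fun n => a n * 0 ^ n).
  refine (C_series_ext _ H0). intros n; simpl; ring.
Qed.

Lemma pow_series_derive_n (a : nat -> C) (r : R) (f : C -> C) (n : nat) :
  (0 < r)%R -> pow_series a r f ->
  pow_series (Nat.iter n dcoef a) r (C_derive_n f n).
Proof.
  intros r0 Hf. induction n as [|n IH]; simpl; auto. now apply pow_series_derive.
Qed.

(** The constant is (n + k)! / k!; for orders of vanishing it is enough that it is nonzero. *)
Lemma iter_dcoef (a : nat -> C) (n k : nat) :
  exists c : C, c <> 0 /\ Nat.iter n dcoef a k = c * a (n + k)%nat.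
Proof.
  revert k. induction n as [|n IH]; intros k; simpl.
  - exists 1. split; [apply C1_nz|ring].
  - destruct (IH (S k)) as [c [Hc E]]. unfold dcoef at 1. rewrite E.
    exists (RtoC (INR (S k)) * c). split.
    + apply Cmult_neq_0; auto. intros H. apply RtoC_inj in H. revert H. now apply not_0_INR.
    + rewrite Nat.add_succ_r. ring.
Qed.

Lemma C_derive_n_0 (a : nat -> C) (r : R) (f : C -> C) (n : nat) :
  (0 < r)%R -> pow_series a r f -> (C_derive_n f n 0 = 0 <-> a n = 0).
Proof.
  intros r0 Hf.
  rewrite (pow_series_at_0 r0 (pow_series_derive_n (n := n) r0 Hf)).
  destruct (iter_dcoef a n 0) as [c [Hc ->]]. rewrite Nat.add_0_r.
  split; intros H.
  - apply NNPP; intros Ha. now apply (Cmult_neq_0 c (a n)).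
  - rewrite H; ring.
Qed.

Lemma pow_series_const (c : C) (r : R) :
  pow_series (fun n => match n with O => c | _ => 0 end) r (fun _ => c).
Proof.
  intros t _.
  (* Some limit exists by comparison with the geometric series of ratio 0; multiplying the series by
     0 then identifies the limit as 0. *)
  assert (H : C_series (fun n => 0 * t ^ n) 0).
  { destruct (C_series_of_abs (u := fun n => (0 * t ^ n)%C) (b := fun n => 0 ^ n)%R) as [l Hl].
    - intros n. rewrite Cmult_0_l, Cmod_0. apply pow_le; lra.
    - exists (/ (1 - 0))%R. apply is_series_geom. rewrite Rabs_R0; lra.
    - refine (C_series_eq (C_series_ext _ (C_series_scal (c := 0) Hl)) _); intros; ring. }
  refine (C_series_eq (C_series_cons (u := fun n => match n with O => c | _ => 0 end * t ^ n)
                         (C_series_ext _ (C_series_tail H))) _);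
    [intros n|]; simpl; ring.
Qed.

Lemma pow_series_mult_var (a : nat -> C) (r : R) (f : C -> C) :
  pow_series a r f ->
  pow_series (fun n => match n with O => 0 | S k => a k end) r (fun t => t * f t).
Proof.
  intros Hf t Ht.
  refine (C_series_eq (C_series_cons (u := fun n => match n with O => 0 | S k => a k end * t ^ n)
            (C_series_ext _ (C_series_scal (c := t) (Hf t Ht)))) _);
    [intros n|]; simpl; ring.
Qed.

Lemma pow_series_div_var (a : nat -> C) (r : R) (f : C -> C) :
  pow_series a r f -> (0 < r)%R -> a O = 0 ->
  exists g, pow_series (fun n => a (S n)) r g /\ forall t, (Cmod t < r)%R -> f t = t * g t.
Proof.
  intros Hf r0 Ha0.
  (* The value at 0 is the constant term of the shifted series, where the quotient is
     meaningless. *)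
  pose (g := fun t => if Ceq_dec t 0 then a 1%nat else f t / t).
  assert (Hg : forall t, (Cmod t < r)%R -> f t = t * g t).
  { intros t Ht. unfold g. destruct (Ceq_dec t 0) as [->|Hn].
    - rewrite (pow_series_at_0 r0 Hf), Ha0. ring.
    - now field. }
  exists g; split; auto. intros t Ht.
  destruct (Ceq_dec t 0) as [Et|Hn].
  - subst t. replace (g 0) with (a 1%nat) by (unfold g; now destruct (Ceq_dec 0 0)).
    assert (H0 := C_series_scal (c := 0) (C_series_tail (Hf 0 Ht))).
    replace (a 1%nat) with (0 * (f 0 - a O * 0 ^ O) + a 1%nat * 0 ^ O) by (simpl; ring).
    apply C_series_cons with (u := fun n => a (S n) * 0 ^ n).
    refine (C_series_ext _ H0). intros n; simpl; ring.
  - assert (H := C_series_scal (c := / t) (C_series_tail (Hf t Ht))).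
    replace (g t) with (/ t * (f t - a O * t ^ O)).
    + refine (C_series_ext _ H). intros n; simpl. field; auto.
    + rewrite (Hg t Ht), Ha0. field; auto.
Qed.

(** * Cauchy products of complex series *)

Fixpoint Csum (u : nat -> C) (n : nat) : C :=
  match n with O => u O | S k => Csum u k + u (S k) end.

Lemma Csum_sum_n (u : nat -> C) (n : nat) : @sum_n C_AbelianMonoid u n = Csum u n.
Proof.
  induction n as [|n IH]; simpl; [apply sum_O|].
  rewrite sum_Sn, IH. reflexivity.
Qed.

Lemma Csum_Re (u : nat -> C) (n : nat) : fst (Csum u n) = sum_f_R0 (fun k => fst (u k)) n.
Proof. induction n as [|n IH]; simpl; auto. now rewrite IH. Qed.

Lemma Csum_Im (u : nat -> C) (n : nat) : snd (Csum u n) = sum_f_R0 (fun k => snd (u k)) n.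
Proof. induction n as [|n IH]; simpl; auto. now rewrite IH. Qed.

Lemma Csum_ext (u v : nat -> C) (n : nat) :
  (forall k, (k <= n)%nat -> u k = v k) -> Csum u n = Csum v n.
Proof.
  induction n as [|n IH]; intros H; simpl; [apply H; lia|].
  rewrite IH by (intros; apply H; lia). now rewrite H by lia.
Qed.

Lemma Csum_scal_r (u : nat -> C) (c : C) (n : nat) :
  Csum u n * c = Csum (fun k => u k * c) n.
Proof. induction n as [|n IH]; simpl; auto. rewrite <- IH; ring. Qed.

(** Balls in C are products of balls, so partial sums converge exactly when both components do; this
    carries the real Cauchy product over to C. *)
Lemma C_series_components (u : nat -> C) (l : C) :
  C_series u l <-> is_series (fun n => fst (u n)) (fst l) /\ is_series (fun n => snd (u n)) (snd l).
Proof.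
  assert (E1 : forall n, sum_n (fun n => fst (u n)) n = fst (@sum_n C_AbelianMonoid u n)).
  { intros n. now rewrite Csum_sum_n, sum_n_Reals, Csum_Re. }
  assert (E2 : forall n, sum_n (fun n => snd (u n)) n = snd (@sum_n C_AbelianMonoid u n)).
  { intros n. now rewrite Csum_sum_n, sum_n_Reals, Csum_Im. }
  split.
  - intros H.
    assert (H' := proj1 (@filterlim_locally nat C_UniformSpace eventually _
                    (@sum_n C_AbelianMonoid u) l) H).
    split; apply filterlim_locally; intros eps.
    + apply filter_imp with (2 := H' eps). intros n [Hn _]. rewrite E1. exact Hn.
    + apply filter_imp with (2 := H' eps). intros n [_ Hn]. rewrite E2. exact Hn.
  - intros [H1 H2].
    assert (H1' := proj1 (@filterlim_locally nat R_UniformSpace eventually _ _ _) H1).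
    assert (H2' := proj1 (@filterlim_locally nat R_UniformSpace eventually _ _ _) H2).
    apply (@filterlim_locally nat C_UniformSpace eventually _ (@sum_n C_AbelianMonoid u) l).
    intros eps.
    apply filter_imp with (2 := filter_and _ _ (H1' eps) (H2' eps)).
    intros n [Hn1 Hn2]. rewrite E1 in Hn1. rewrite E2 in Hn2. split; assumption.
Qed.

(** Four real Cauchy products, of real and imaginary parts, are combined as in the product of two
    complex numbers. Absolute convergence passes to the parts, which are bounded by the modulus. *)
Lemma C_series_mult (u v : nat -> C) (l m : C) :
  C_series u l -> C_series v m ->
  ex_series (fun n => Cmod (u n)) -> ex_series (fun n => Cmod (v n)) ->
  C_series (fun n => Csum (fun k => u k * v (n - k)%nat) n) (l * m).
Proof.
  intros Hu Hv Au Av.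
  assert (Hr : forall c : C, (Rabs (fst c) <= Cmod c)%R).
  { intros c. eapply Rle_trans; [apply Rmax_l|apply (Rmax_Cmod c)]. }
  assert (Hi : forall c : C, (Rabs (snd c) <= Cmod c)%R).
  { intros c. eapply Rle_trans; [apply Rmax_r|apply (Rmax_Cmod c)]. }
  assert (Ab : forall (p : C -> R) (w : nat -> C), (forall c, (Rabs (p c) <= Cmod c)%R) ->
     ex_series (fun n => Cmod (w n)) -> ex_series (fun n => Rabs (p (w n)))).
  { intros p w Hp Hw. apply (@ex_series_le R_AbsRing R_CompleteNormedModule) with (2 := Hw).
    intros n. change (Rabs (Rabs (p (w n))) <= Cmod (w n))%R. now rewrite Rabs_Rabsolu. }
  apply C_series_components in Hu. apply C_series_components in Hv.
  destruct Hu as [Hu1 Hu2], Hv as [Hv1 Hv2].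
  assert (M := fun p q (Hp : forall c, (Rabs (p c) <= Cmod c)%R)
     (Hq : forall c, (Rabs (q c) <= Cmod c)%R) lp lq Hup Hvq =>
     is_series_mult (fun n => p (u n)) (fun n => q (v n)) lp lq Hup Hvq (Ab p u Hp Au) (Ab q v Hq Av)).
  apply C_series_components. split.
  - assert (H := is_series_minus _ _ _ _ (M _ _ Hr Hr _ _ Hu1 Hv1) (M _ _ Hi Hi _ _ Hu2 Hv2)).
    eapply is_series_ext; [|exact H]. intros n. rewrite Csum_Re.
    symmetry. exact (minus_sum _ _ _).
  - assert (H := is_series_plus _ _ _ _ (M _ _ Hr Hi _ _ Hu1 Hv2) (M _ _ Hi Hr _ _ Hu2 Hv1)).
    eapply is_series_ext; [|exact H]. intros n. rewrite Csum_Im.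
    symmetry. exact (plus_sum _ _ _).
Qed.

Lemma pow_series_mult (a b : nat -> C) (r : R) (f g : C -> C) :
  pow_series a r f -> pow_series b r g ->
  pow_series (fun n => Csum (fun k => a k * b (n - k)%nat) n) r (fun t => f t * g t).
Proof.
  intros Hf Hg t Ht.
  assert (H : forall c h, pow_series c r h -> ex_series (fun n => Cmod (c n * t ^ n))).
  { intros c h Hc. eapply ex_series_ext;
      [|apply (abs_conv_series (pow_series_abs_conv Hc) (s := Cmod t))].
    - intros n. now rewrite Cmod_mult, Cmod_pow.
    - split; [apply Cmod_ge_0|auto]. }
  refine (C_series_ext _ (C_series_mult (Hf t Ht) (Hg t Ht) (H _ _ Hf) (H _ _ Hg))).
  intros n. rewrite Csum_scal_r. apply Csum_ext. intros k Hk.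
  replace (t ^ n) with (t ^ k * t ^ (n - k)); [ring|].
  rewrite <- Cpow_add_r. f_equal. lia.
Qed.

Lemma pow_series_restrict (a : nat -> C) (r r' : R) (f : C -> C) :
  (r' <= r)%R -> pow_series a r f -> pow_series a r' f.
Proof. intros Hr Hf t Ht. apply Hf. lra. Qed.

(** * Holomorphic germs *)

Definition near (P : C -> Prop) : Prop := locally (0 : C) P.

Lemma near_iff (P : C -> Prop) :
  near P <-> exists r : R, (0 < r)%R /\ forall t, (Cmod t < r)%R -> P t.
Proof. apply locally_0_iff. Qed.

Lemma near_and (P Q : C -> Prop) : near P -> near Q -> near (fun t => P t /\ Q t).
Proof. apply filter_and. Qed.

Lemma near_imp (P Q : C -> Prop) : (forall t, P t -> Q t) -> near P -> near Q.
Proof. apply filter_imp. Qed.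

Lemma near_all (P : C -> Prop) : (forall t, P t) -> near P.
Proof. intros H. now apply filter_forall. Qed.

Lemma near_0 (P : C -> Prop) : near P -> P 0.
Proof. apply locally_singleton. Qed.

Lemma near_locally (P : C -> Prop) : near P -> near (fun t => locally t P).
Proof. apply locally_locally. Qed.

Notation hol := holomorphic_germ.

Lemma hol_ext (f g : C -> C) : near (fun t => f t = g t) -> hol f -> hol g.
Proof.
  rewrite near_iff, !holomorphic_germ_iff. intros [d [d0 Hd]] [a [r [r0 Ha]]].
  exists a, (Rmin d r). split; [now apply Rmin_glb_lt|]. intros t Ht.
  rewrite <- Hd by (eapply Rlt_le_trans; [exact Ht|apply Rmin_l]).
  apply Ha. eapply Rlt_le_trans; [exact Ht|apply Rmin_r].
Qed.

Lemma hol_common (f g : C -> C) :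
  hol f -> hol g -> exists a b r, (0 < r)%R /\ pow_series a r f /\ pow_series b r g.
Proof.
  rewrite !holomorphic_germ_iff. intros [a [r [r0 Ha]]] [b [s [s0 Hb]]].
  exists a, b, (Rmin r s). split; [now apply Rmin_glb_lt|].
  split.
  - exact (pow_series_restrict (Rmin_l r s) Ha).
  - exact (pow_series_restrict (Rmin_r r s) Hb).
Qed.

Lemma hol_const (c : C) : hol (fun _ => c).
Proof. apply holomorphic_germ_iff. eexists _, 1%R. split; [lra|apply pow_series_const]. Qed.

Lemma hol_mult (f g : C -> C) : hol f -> hol g -> hol (fun t => f t * g t).
Proof.
  intros Hf Hg. destruct (hol_common Hf Hg) as [a [b [r [r0 [Ha Hb]]]]].
  apply holomorphic_germ_iff. eexists _, r. split; auto. exact (pow_series_mult Ha Hb).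
Qed.

Lemma hol_plus (f g : C -> C) : hol f -> hol g -> hol (fun t => f t + g t).
Proof.
  intros Hf Hg. destruct (hol_common Hf Hg) as [a [b [r [r0 [Ha Hb]]]]].
  apply holomorphic_germ_iff. exists (fun n => a n + b n), r. split; auto. intros t Ht.
  refine (C_series_ext _ (C_series_plus (Ha t Ht) (Hb t Ht))). intros n; simpl; ring.
Qed.

Lemma hol_id : hol (fun t => t).
Proof.
  apply holomorphic_germ_iff. eexists _, 1%R. split; [lra|].
  intros t Ht. refine (C_series_eq (pow_series_mult_var (@pow_series_const 1 1) Ht) _).
  ring.
Qed.

Lemma hol_scal (c : C) (f : C -> C) : hol f -> hol (fun t => c * f t).
Proof. apply hol_mult, hol_const. Qed.

Lemma hol_opp (f : C -> C) : hol f -> hol (fun t => - f t).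
Proof.
  intros H. refine (hol_ext _ (hol_scal (- (1)) H)). apply near_all; intros t; ring.
Qed.

Lemma hol_minus (f g : C -> C) : hol f -> hol g -> hol (fun t => f t - g t).
Proof. intros Hf Hg. apply hol_plus; auto using hol_opp. Qed.

Lemma hol_pow (f : C -> C) (n : nat) : hol f -> hol (fun t => f t ^ n).
Proof.
  intros H. induction n as [|n IH]; simpl; [apply hol_const|now apply hol_mult].
Qed.

Lemma hol_derive (f : C -> C) : hol f -> hol (C_derive f).
Proof.
  rewrite !holomorphic_germ_iff. intros [a [r [r0 Ha]]].
  exists (dcoef a), r. split; auto. now apply pow_series_derive.
Qed.

Lemma hol_cdiff (f : C -> C) : hol f -> near (fun t => cdiff f t (C_derive f t)).
Proof.
  rewrite holomorphic_germ_iff. intros [a [r [r0 Ha]]].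
  apply near_iff. exists r. split; auto. apply (pow_series_derive Ha).
Qed.

Lemma derive_ext (f g : C -> C) :
  hol f -> near (fun t => f t = g t) -> near (fun t => C_derive g t = C_derive f t).
Proof.
  intros Hf H. refine (near_imp _ (near_and (hol_cdiff Hf) (near_locally H))).
  intros t [H1 H2]. apply cdiff_derive. exact (cdiff_ext_loc H2 H1).
Qed.

Lemma derive_plus (f g : C -> C) : hol f -> hol g ->
  near (fun t => C_derive (fun t => f t + g t) t = C_derive f t + C_derive g t).
Proof.
  intros Hf Hg. refine (near_imp _ (near_and (hol_cdiff Hf) (hol_cdiff Hg))).
  intros t [H1 H2]. apply cdiff_derive. now apply cdiff_plus.
Qed.

Lemma derive_mult (f g : C -> C) : hol f -> hol g ->
  near (fun t => C_derive (fun t => f t * g t) t = C_derive f t * g t + f t * C_derive g t).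
Proof.
  intros Hf Hg. refine (near_imp _ (near_and (hol_cdiff Hf) (hol_cdiff Hg))).
  intros t [H1 H2]. apply cdiff_derive. now apply cdiff_mult.
Qed.

Lemma derive_const (c t : C) : C_derive (fun _ => c) t = 0.
Proof. apply cdiff_derive, cdiff_const. Qed.

Lemma derive_id (t : C) : C_derive (fun t => t) t = 1.
Proof. apply cdiff_derive, cdiff_id. Qed.

Lemma derive_scal (c : C) (f : C -> C) : hol f ->
  near (fun t => C_derive (fun t => c * f t) t = c * C_derive f t).
Proof.
  intros Hf. refine (near_imp _ (derive_mult (hol_const c) Hf)). intros t ->.
  rewrite derive_const. ring.
Qed.

Lemma near_sym (f g : C -> C) : near (fun t => f t = g t) -> near (fun t => g t = f t).
Proof. apply near_imp. auto. Qed.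

Lemma hol_nonzero_near (f : C -> C) : hol f -> f 0 <> 0 -> near (fun t => f t <> 0).
Proof.
  intros Hf H0. apply hol_cdiff, near_0 in Hf.
  assert (P0 : (0 < Cmod (f 0))%R) by now apply Cmod_gt_0.
  destruct (Hf 1%R) as [d [d0 Hd]]; [lra|].
  set (l := C_derive f 0) in *. assert (L0 := Cmod_ge_0 l).
  (* Within this radius |f(t) - f(0)| <= (|l| + 1) |t| < |f(0)|, so f(t) = 0 is impossible. *)
  apply near_iff. exists (Rmin d (Cmod (f 0) / (Cmod l + 2))%R).
  assert (Hc : (0 < Cmod (f 0) / (Cmod l + 2))%R) by (apply Rdiv_lt_0_compat; lra).
  split; [now apply Rmin_glb_lt|].
  intros t Ht Ft.
  assert (h1 : (Cmod t < d)%R) by (eapply Rlt_le_trans; [exact Ht|apply Rmin_l]).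
  assert (h2 : (Cmod t < Cmod (f 0) / (Cmod l + 2))%R)
    by (eapply Rlt_le_trans; [exact Ht|apply Rmin_r]).
  specialize (Hd t h1). rewrite Cplus_0_l, Ft in Hd.
  assert (H3 : (Cmod (f 0) <= Cmod (0 - f 0 - l * t) + Cmod (l * t))%R).
  { rewrite <- (Cmod_opp (f 0)). replace (- f 0) with ((0 - f 0 - l * t) + l * t) by ring.
    apply Cmod_triangle. }
  rewrite Cmod_mult in H3.
  assert (H4 : (Cmod t * (Cmod l + 2) < Cmod (f 0))%R).
  { apply Rlt_le_trans with (Cmod (f 0) / (Cmod l + 2) * (Cmod l + 2))%R; [|right; field; lra].
    apply Rmult_lt_compat_r; lra. }
  assert (T0 := Cmod_ge_0 t). lra.
Qed.

Lemma near_punctured (P : C -> Prop) :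
  near P -> forall Q : C -> Prop, near Q -> exists t : C, t <> 0 /\ P t /\ Q t.
Proof.
  intros HP Q HQ. destruct (proj1 (near_iff _) (near_and HP HQ)) as [r [r0 H]].
  exists (RtoC (r / 2)%R). split.
  - intros E. apply RtoC_inj in E. lra.
  - apply H. rewrite Cmod_R, Rabs_pos_eq; lra.
Qed.

Lemma hol_zero_of_punctured (f : C -> C) :
  hol f -> near (fun t => t <> 0 -> f t = 0) -> near (fun t => f t = 0).
Proof.
  intros Hf H.
  assert (H0 : f 0 = 0).
  { apply NNPP. intros Hn.
    destruct (near_punctured H (hol_nonzero_near Hf Hn)) as [t [t0 [H1 H2]]]. auto. }
  refine (near_imp _ H). intros t Ht. destruct (Ceq_dec t 0) as [->|]; auto.
Qed.

(** Off 0 one divides by t^k; the value at 0 follows by continuity, in the form of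
    [hol_nonzero_near]. *)
Lemma hol_pow_cancel (f g : C -> C) (k : nat) :
  hol f -> hol g -> near (fun t => t ^ k * f t = t ^ k * g t) -> near (fun t => f t = g t).
Proof.
  intros Hf Hg H.
  refine (near_imp _ (hol_zero_of_punctured (hol_minus Hf Hg) _)).
  - intros t E. replace (f t) with (f t - g t + g t) by ring. rewrite E; ring.
  - refine (near_imp _ H). intros t E t0.
    assert (Hp := Cpow_nz t k t0).
    replace (f t - g t) with (/ t ^ k * (t ^ k * f t - t ^ k * g t)) by (field; auto).
    rewrite E. ring.
Qed.

(** * Orders of vanishing *)

(** Divisibility by t^k in the ring of germs, instead of vanishing derivatives: products, sums and
    the operator t d/dt then act directly on the cofactor [g]. The link with [ord] is made in
    [ord_has_order] and [ord_zero]. *)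
Definition vanishes (f : C -> C) (k : nat) : Prop :=
  exists g, hol g /\ near (fun t => f t = t ^ k * g t).

Definition has_order (f : C -> C) (k : nat) : Prop :=
  exists g, hol g /\ g 0 <> 0 /\ near (fun t => f t = t ^ k * g t).

Definition zero_germ (f : C -> C) : Prop := near (fun t => f t = 0).

Lemma has_order_vanishes (f : C -> C) (k l : nat) :
  has_order f l -> (k <= l)%nat -> vanishes f k.
Proof.
  intros [g [Hg [_ H]]] Hk. exists (fun t => t ^ (l - k) * g t). split.
  - apply hol_mult; auto. apply hol_pow, hol_id.
  - refine (near_imp _ H). intros t ->. replace l with (k + (l - k))%nat at 1 by lia.
    rewrite Cpow_add_r. ring.
Qed.

Lemma zero_vanishes (f : C -> C) (k : nat) : zero_germ f -> vanishes f k.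
Proof.
  intros H. exists (fun _ => 0). split; [apply hol_const|].
  refine (near_imp _ H). intros t ->; ring.
Qed.

Lemma vanishes_hol (f : C -> C) (k : nat) : vanishes f k -> hol f.
Proof.
  intros [g [Hg H]]. apply (hol_ext (near_sym H)). apply hol_mult; auto.
  apply hol_pow, hol_id.
Qed.

Lemma has_order_hol (f : C -> C) (k : nat) : has_order f k -> hol f.
Proof. intros H. apply (vanishes_hol (has_order_vanishes H (le_n k))). Qed.

Lemma has_order_not_vanishes (f : C -> C) (k : nat) : has_order f k -> ~ vanishes f (S k).
Proof.
  intros [g [Hg [H0 H]]] [p [Hp Hf]].
  assert (Htp : hol (fun t => t * p t)) by (apply hol_mult; auto using hol_id).
  assert (E : near (fun t => g t = t * p t)).
  { apply (hol_pow_cancel (k := k)); auto.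
    refine (near_imp _ (near_and H Hf)). intros t [<- ->]. simpl; ring. }
  apply near_0 in E. apply H0. rewrite E. ring.
Qed.

Lemma has_order_nonzero (f : C -> C) (k : nat) : has_order f k -> ~ zero_germ f.
Proof. intros H H0. exact (has_order_not_vanishes H (zero_vanishes (S k) H0)). Qed.

Lemma has_order_unique (f : C -> C) (k l : nat) : has_order f k -> has_order f l -> k = l.
Proof.
  intros Hk Hl. destruct (Nat.lt_trichotomy k l) as [H|[H|H]]; auto; exfalso.
  - exact (has_order_not_vanishes Hk (has_order_vanishes Hl H)).
  - exact (has_order_not_vanishes Hl (has_order_vanishes Hk H)).
Qed.

Lemma pow_series_factor (k : nat) (a : nat -> C) (r : R) (f : C -> C) :
  pow_series a r f -> (0 < r)%R -> (forall j, (j < k)%nat -> a j = 0) ->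
  exists g, pow_series (fun n => a (k + n)%nat) r g /\
    forall t, (Cmod t < r)%R -> f t = t ^ k * g t.
Proof.
  revert a f. induction k as [|k IH]; intros a f Hf r0 Ha.
  - exists f. split; auto. intros t _. simpl; ring.
  - destruct (pow_series_div_var Hf r0) as [p [Hp Ep]]; [apply Ha; lia|].
    destruct (IH _ _ Hp r0) as [g [Hg Eg]]; [intros j Hj; apply Ha; lia|].
    exists g. split; auto. intros t Ht. rewrite (Ep t Ht), (Eg t Ht). simpl; ring.
Qed.

Lemma least_nat (P : nat -> Prop) :
  (exists n, P n) -> exists n, P n /\ forall j, (j < n)%nat -> ~ P j.
Proof.
  intros [n Hn]. induction n as [n IH] using (well_founded_induction Wf_nat.lt_wf).
  destruct (classic (exists j, (j < n)%nat /\ P j)) as [[j [Hj Pj]]|H].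
  - exact (IH j Hj Pj).
  - exists n. split; auto. intros j Hj Pj. apply H. eauto.
Qed.

(** The order is the index of the first nonzero coefficient. The coefficients are kept in the
    conclusion because [ord] is defined by derivatives at 0, which are nonzero multiples of them. *)
Lemma pow_series_order_cases (a : nat -> C) (r : R) (f : C -> C) :
  (0 < r)%R -> pow_series a r f ->
  (zero_germ f /\ forall n, a n = 0) \/
  exists k, has_order f k /\ a k <> 0 /\ forall j, (j < k)%nat -> a j = 0.
Proof.
  intros r0 Hf. destruct (classic (exists n, a n <> 0)) as [H|H].
  - right. destruct (least_nat H) as [k [Hk Hj]].
    assert (Hj' : forall j, (j < k)%nat -> a j = 0) by (intros j Hlt; apply NNPP; now apply Hj).
    destruct (pow_series_factor Hf r0 Hj') as [g [Hg E]].
    exists k. split; auto. exists g. repeat split.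
    + apply holomorphic_germ_iff. eauto.
    + rewrite (pow_series_at_0 r0 Hg). now rewrite Nat.add_0_r.
    + apply near_iff. eauto.
  - left. assert (Ha : forall n, a n = 0) by (intros n; apply NNPP; eauto).
    split; auto. apply near_iff. exists r. split; auto. intros t Ht.
    assert (Hz := @pow_series_const 0 r t Ht).
    refine (C_series_unique (C_series_ext _ (Hf t Ht)) Hz).
    intros n. rewrite Ha. destruct n; reflexivity.
Qed.

Lemma order_cases (f : C -> C) : hol f -> zero_germ f \/ exists k, has_order f k.
Proof.
  rewrite holomorphic_germ_iff. intros [a [r [r0 Ha]]].
  destruct (pow_series_order_cases r0 Ha) as [[H _]|[k [H _]]]; eauto.
Qed.

Lemma ord_zero (f : C -> C) : zero_germ f -> ord f = p_infty.
Proof.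
  intros H.
  assert (Hn : forall n, near (fun t => C_derive_n f n t = 0)).
  { induction n as [|n IH]; simpl; auto.
    refine (near_imp _ (derive_ext (hol_const 0) (near_sym IH))).
    intros t ->. apply derive_const. }
  apply is_glb_Rbar_unique. split.
  - intros x [n [_ Hx]]. destruct Hx. exact (near_0 (Hn n)).
  - intros b _. destruct b; exact I.
Qed.

Lemma ord_has_order (f : C -> C) (k : nat) : has_order f k -> ord f = Finite (INR k).
Proof.
  intros H. assert (Hf := has_order_hol H). apply holomorphic_germ_iff in Hf.
  destruct Hf as [a [r [r0 Ha]]].
  destruct (pow_series_order_cases r0 Ha) as [[H0 _]|[j [Hj [Hj1 Hj2]]]].
  - destruct (has_order_nonzero H H0).
  - rewrite (has_order_unique H Hj).
    apply is_glb_Rbar_unique. split.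
    + intros x [n [-> Hn]]. simpl. apply le_INR.
      destruct (Nat.le_gt_cases j n) as [|Hlt]; auto. exfalso.
      apply Hn. rewrite (C_derive_n_0 n r0 Ha). auto.
    + intros b Hb. apply Hb. exists j. split; auto.
      intros E. apply Hj1. now apply (C_derive_n_0 j r0 Ha).
Qed.

Lemma ord_zero_iff (f : C -> C) : hol f -> ord f = p_infty -> zero_germ f.
Proof.
  intros Hf H. destruct (order_cases Hf) as [|[k Hk]]; auto.
  rewrite (ord_has_order Hk) in H. discriminate.
Qed.

Lemma has_order_of_ord (f : C -> C) (k : nat) :
  hol f -> ord f = Finite (INR k) -> has_order f k.
Proof.
  intros Hf H. destruct (order_cases Hf) as [H0|[j Hj]].
  - rewrite (ord_zero H0) in H. discriminate.
  - rewrite (ord_has_order Hj) in H. injection H as H. apply INR_eq in H. now subst.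
Qed.

Lemma zero_ext (f g : C -> C) :
  near (fun t => f t = g t) -> zero_germ f -> zero_germ g.
Proof.
  intros H H0. refine (near_imp _ (near_and H H0)). now intros t [<- ->].
Qed.

Lemma has_order_ext (f g : C -> C) (k : nat) :
  near (fun t => f t = g t) -> has_order f k -> has_order g k.
Proof.
  intros H [p [Hp [P0 Hf]]]. exists p. repeat split; auto.
  refine (near_imp _ (near_and H Hf)). now intros t [<- ->].
Qed.

Lemma ord_ext (f g : C -> C) : hol f -> near (fun t => f t = g t) -> ord f = ord g.
Proof.
  intros Hf H. destruct (order_cases Hf) as [H0|[k Hk]].
  - now rewrite (ord_zero H0), (ord_zero (zero_ext H H0)).
  - now rewrite (ord_has_order Hk), (ord_has_order (has_order_ext H Hk)).
Qed.

Lemma vanishes_of_ord (f : C -> C) (k : nat) :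
  hol f -> Rbar_le (INR k) (ord f) -> vanishes f k.
Proof.
  intros Hf H. destruct (order_cases Hf) as [H0|[j Hj]].
  - now apply zero_vanishes.
  - rewrite (ord_has_order Hj) in H. apply (has_order_vanishes Hj). now apply INR_le.
Qed.

Lemma ord_of_vanishes (f : C -> C) (k : nat) : vanishes f k -> Rbar_le (INR k) (ord f).
Proof.
  intros Hv. destruct (order_cases (vanishes_hol Hv)) as [H0|[j Hj]].
  - now rewrite (ord_zero H0).
  - rewrite (ord_has_order Hj). simpl. apply le_INR.
    destruct (Nat.le_gt_cases k j) as [|Hlt]; auto. exfalso.
    apply (has_order_not_vanishes Hj). destruct Hv as [g [Hg E]].
    exists (fun t => t ^ (k - S j) * g t). split.
    + apply hol_mult; auto. apply hol_pow, hol_id.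
    + refine (near_imp _ E). intros t ->. replace k with (S j + (k - S j))%nat at 1 by lia.
      rewrite Cpow_add_r. ring.
Qed.

Lemma has_order_plus (f g : C -> C) (k : nat) :
  has_order f k -> vanishes g (S k) -> has_order (fun t => f t + g t) k.
Proof.
  intros [p [Hp [P0 Ef]]] [q [Hq Eg]]. exists (fun t => p t + t * q t). repeat split.
  - apply hol_plus; auto. apply hol_mult; auto using hol_id.
  - now rewrite Cmult_0_l, Cplus_0_r.
  - refine (near_imp _ (near_and Ef Eg)). intros t [-> ->]. simpl; ring.
Qed.

Lemma has_order_mult (f g : C -> C) (k l : nat) :
  has_order f k -> has_order g l -> has_order (fun t => f t * g t) (k + l).
Proof.
  intros [p [Hp [P0 Ef]]] [q [Hq [Q0 Eg]]]. exists (fun t => p t * q t). repeat split.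
  - now apply hol_mult.
  - now apply Cmult_neq_0.
  - refine (near_imp _ (near_and Ef Eg)). intros t [-> ->]. rewrite Cpow_add_r. ring.
Qed.

Lemma has_order_scal (c : C) (f : C -> C) (k : nat) :
  c <> 0 -> has_order f k -> has_order (fun t => c * f t) k.
Proof.
  intros Hc [p [Hp [P0 Ef]]]. exists (fun t => c * p t). repeat split.
  - now apply hol_scal.
  - now apply Cmult_neq_0.
  - refine (near_imp _ Ef). intros t ->. ring.
Qed.

Lemma ord_scal (c : C) (f : C -> C) : hol f -> c <> 0 -> ord (fun t => c * f t) = ord f.
Proof.
  intros Hf Hc. destruct (order_cases Hf) as [H|[k Hk]].
  - rewrite (ord_zero H). apply ord_zero. refine (near_imp _ H). intros t ->; ring.
  - rewrite (ord_has_order Hk). apply ord_has_order. now apply has_order_scal.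
Qed.

(** Orders add under multiplication, so a product of two germs of finite order has finite order.
    This is what splits a reducible equation along a curve. *)
Lemma zero_germ_domain (f g : C -> C) :
  hol f -> hol g -> zero_germ (fun t => f t * g t) -> zero_germ f \/ zero_germ g.
Proof.
  intros Hf Hg H. destruct (order_cases Hf) as [|[k Hk]]; auto.
  destruct (order_cases Hg) as [|[l Hl]]; auto.
  destruct (has_order_nonzero (has_order_mult Hk Hl) H).
Qed.

Lemma ord_plus_lt (f g : C -> C) : hol f -> hol g -> Rbar_lt (ord f) (ord g) ->
  ord (fun t => f t + g t) = ord f.
Proof.
  intros Hf Hg H. destruct (order_cases Hf) as [H0|[k Hk]].
  - rewrite (ord_zero H0) in H. destruct (ord g); destruct H.
  - rewrite (ord_has_order Hk) in *. apply ord_has_order. apply has_order_plus; auto.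
    destruct (order_cases Hg) as [H0|[l Hl]]; [now apply zero_vanishes|].
    rewrite (ord_has_order Hl) in H. apply (has_order_vanishes Hl).
    apply INR_lt in H. lia.
Qed.

(** The elimination step: [c] is minus the quotient of the leading coefficients, so the terms in t^e
    cancel. *)
Lemma reduce_order (f h : C -> C) (e : nat) :
  has_order f e -> hol h -> ord h = Finite (INR e) ->
  exists c, Rbar_lt (INR e) (ord (fun t => h t + c * f t)).
Proof.
  intros [p [Hp [P0 Ef]]] Hh Ho.
  destruct (has_order_of_ord Hh Ho) as [q [Hq [Q0 Eh]]].
  exists (- (q 0 / p 0)).
  apply Rbar_lt_le_trans with (INR (S e)); [exact (lt_INR _ _ (Nat.lt_succ_diag_r e))|].
  apply ord_of_vanishes.
  assert (Hm : hol (fun t => q t + - (q 0 / p 0) * p t)).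
  { apply hol_plus; auto. now apply hol_scal. }
  assert (Hv : vanishes (fun t => q t + - (q 0 / p 0) * p t) 1).
  { destruct (order_cases Hm) as [H0|[k Hk]]; [now apply zero_vanishes|].
    apply (has_order_vanishes Hk). destruct k; [|lia]. exfalso.
    destruct Hk as [s [_ [Hs Es]]]. apply Hs. apply near_0 in Es.
    replace (s 0) with (0 ^ 0 * s 0) by (simpl; ring). rewrite <- Es. field. auto. }
  destruct Hv as [s [Hs Es]]. exists s. split; auto.
  refine (near_imp _ (near_and Es (near_and Ef Eh))). intros t [E [-> ->]].
  replace (t ^ S e * s t) with (t ^ e * (t ^ 1 * s t)) by (simpl; ring).
  rewrite <- E. ring.
Qed.

(** * Wronskians *)

Notation D1 f := (C_derive f).
Notation D2 f := (C_derive (C_derive f)).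
Notation D3 f := (C_derive (C_derive (C_derive f))).

(** Equivalently the Wronskian of 1, f, g. The germ 1 has order 0, which is why the order formulas
    ask for orders that are positive as well as distinct. *)
Definition W2 (f g : C -> C) (t : C) : C := D1 f t * D2 g t - D2 f t * D1 g t.

Definition W3 (f g h : C -> C) (t : C) : C :=
  D1 f t * (D2 g t * D3 h t - D3 g t * D2 h t)
  - D2 f t * (D1 g t * D3 h t - D3 g t * D1 h t)
  + D3 f t * (D1 g t * D2 h t - D2 g t * D1 h t).

Definition lincomb (p q : C) (f g : C -> C) (t : C) : C := p * f t + q * g t.

Lemma hol_lincomb (p q : C) (f g : C -> C) : hol f -> hol g -> hol (lincomb p q f g).
Proof. intros Hf Hg. apply hol_plus; now apply hol_scal. Qed.

Lemma hol_derivs (f : C -> C) : hol f -> hol (D1 f) /\ hol (D2 f) /\ hol (D3 f).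
Proof. intros H. repeat split; repeat apply hol_derive; auto. Qed.

Lemma derive_lincomb (p q : C) (f g : C -> C) : hol f -> hol g ->
  near (fun t => D1 (lincomb p q f g) t = lincomb p q (D1 f) (D1 g) t).
Proof.
  intros Hf Hg.
  refine (near_imp _ (near_and (derive_plus (hol_scal p Hf) (hol_scal q Hg))
                        (near_and (derive_scal p Hf) (derive_scal q Hg)))).
  intros t [E [Ef Eg]]. unfold lincomb in *. now rewrite E, Ef, Eg.
Qed.

Lemma derive_trans (f g h : C -> C) : hol f ->
  near (fun t => D1 f t = g t) -> near (fun t => D1 g t = h t) ->
  near (fun t => D2 f t = h t).
Proof.
  intros Hf H1 H2.
  refine (near_imp _ (near_and H2 (derive_ext (hol_derive Hf) H1))).
  intros t [<- ->]. reflexivity.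
Qed.

Lemma derivs_lincomb (p q : C) (f g : C -> C) : hol f -> hol g ->
  near (fun t => D1 (lincomb p q f g) t = p * D1 f t + q * D1 g t /\
                 D2 (lincomb p q f g) t = p * D2 f t + q * D2 g t /\
                 D3 (lincomb p q f g) t = p * D3 f t + q * D3 g t).
Proof.
  intros Hf Hg. destruct (hol_derivs Hf) as [F1 [F2 F3]].
  destruct (hol_derivs Hg) as [G1 [G2 G3]].
  assert (Hl := hol_lincomb p q Hf Hg).
  assert (E1 := derive_lincomb p q Hf Hg).
  assert (E2 := derive_trans Hl E1 (derive_lincomb p q F1 G1)).
  assert (E3 := derive_trans (hol_derive Hl) E2 (derive_lincomb p q F2 G2)).
  exact (near_and E1 (near_and E2 E3)).
Qed.

Lemma derive_mult_plus (f g h k : C -> C) : hol f -> hol g -> hol h -> hol k ->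
  near (fun t => C_derive (fun s => f s * g s + h s * k s) t
     = (D1 f t * g t + f t * D1 g t) + (D1 h t * k t + h t * D1 k t)).
Proof.
  intros Hf Hg Hh Hk.
  refine (near_imp _ (near_and (derive_plus (hol_mult Hf Hg) (hol_mult Hh Hk))
                        (near_and (derive_mult Hf Hg) (derive_mult Hh Hk)))).
  intros t [E [Ef Eg]]. now rewrite E, Ef, Eg.
Qed.

Definition sqnorm (x y : C -> C) (t : C) : C := x t * x t + y t * y t.

Lemma hol_sqnorm (x y : C -> C) : hol x -> hol y -> hol (sqnorm x y).
Proof. intros Hx Hy. apply hol_plus; now apply hol_mult. Qed.

Lemma derivs_sqnorm (x y : C -> C) : hol x -> hol y ->
  near (fun t => D1 (sqnorm x y) t = 2 * (x t * D1 x t + y t * D1 y t) /\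
     D2 (sqnorm x y) t = 2 * (D1 x t ^ 2 + D1 y t ^ 2 + x t * D2 x t + y t * D2 y t) /\
     D3 (sqnorm x y) t = 2 * (3 * (D1 x t * D2 x t + D1 y t * D2 y t)
                              + x t * D3 x t + y t * D3 y t)).
Proof.
  intros Hx Hy. destruct (hol_derivs Hx) as [X1 [X2 X3]].
  destruct (hol_derivs Hy) as [Y1 [Y2 Y3]].
  assert (Hu := hol_sqnorm Hx Hy).
  (* The intermediate derivatives are written as sums of products, the shape to which
     [derive_mult_plus] applies again. *)
  pose (u1 := fun t => x t * (2 * D1 x t) + y t * (2 * D1 y t)).
  pose (u2 := fun t => (D1 x t * (2 * D1 x t) + D1 y t * (2 * D1 y t))
                    + (x t * (2 * D2 x t) + y t * (2 * D2 y t))).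
  assert (E1 : near (fun t => D1 (sqnorm x y) t = u1 t)).
  { refine (near_imp _ (derive_mult_plus Hx Hx Hy Hy)). intros t E.
    unfold sqnorm, u1. rewrite E. ring. }
  assert (E2 : near (fun t => D2 (sqnorm x y) t = u2 t)).
  { refine (derive_trans Hu E1 _).
    refine (near_imp _ (near_and (derive_mult_plus Hx (hol_scal 2 X1) Hy (hol_scal 2 Y1))
              (near_and (derive_scal 2 X1) (derive_scal 2 Y1)))).
    intros t [E [Ex Ey]]. unfold u1, u2. rewrite E, Ex, Ey. ring. }
  assert (E3 : near (fun t => D3 (sqnorm x y) t = 2 * (3 * (D1 x t * D2 x t + D1 y t * D2 y t)
                              + x t * D3 x t + y t * D3 y t))).
  { refine (derive_trans (hol_derive Hu) E2 _).
    assert (S1 := hol_scal 2 X1). assert (S2 := hol_scal 2 X2).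
    assert (T1 := hol_scal 2 Y1). assert (T2 := hol_scal 2 Y2).
    refine (near_imp _ (near_and (derive_plus (hol_plus (hol_mult X1 S1) (hol_mult Y1 T1))
                                    (hol_plus (hol_mult Hx S2) (hol_mult Hy T2)))
              (near_and (near_and (derive_mult_plus X1 S1 Y1 T1) (derive_mult_plus Hx S2 Hy T2))
              (near_and (near_and (derive_scal 2 X1) (derive_scal 2 Y1))
                 (near_and (derive_scal 2 X2) (derive_scal 2 Y2)))))).
    intros t [E [[Ea Eb] [[A1 A2] [A3 A4]]]]. unfold u2.
    rewrite E, Ea, Eb, A1, A2, A3, A4. ring. }
  refine (near_imp _ (near_and E1 (near_and E2 E3))).
  intros t [F1 [F2 F3]]. rewrite F1, F2, F3. unfold u1, u2. repeat split; ring.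
Qed.

Lemma hol_W2 (f g : C -> C) : hol f -> hol g -> hol (W2 f g).
Proof.
  intros Hf Hg. destruct (hol_derivs Hf) as [F1 [F2 F3]].
  destruct (hol_derivs Hg) as [G1 [G2 G3]].
  apply hol_minus; now apply hol_mult.
Qed.

Lemma hol_W3 (f g h : C -> C) : hol f -> hol g -> hol h -> hol (W3 f g h).
Proof.
  intros Hf Hg Hh. destruct (hol_derivs Hf) as [F1 [F2 F3]].
  destruct (hol_derivs Hg) as [G1 [G2 G3]]. destruct (hol_derivs Hh) as [H1 [H2 H3]].
  apply hol_plus; [apply hol_minus|]; apply hol_mult; auto; apply hol_minus; now apply hol_mult.
Qed.

Lemma zero_germ_derivs (f : C -> C) : zero_germ f ->
  near (fun t => D1 f t = 0 /\ D2 f t = 0 /\ D3 f t = 0).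
Proof.
  intros H.
  assert (S : forall g, zero_germ g -> zero_germ (D1 g)).
  { intros g Hg. refine (near_imp _ (derive_ext (hol_const 0) (near_sym Hg))).
    intros t ->. apply derive_const. }
  exact (near_and (S _ H) (near_and (S _ (S _ H)) (S _ (S _ (S _ H))))).
Qed.

(** * Orders of Wronskians through the Euler operator t d/dt *)

Lemma pow_euler (n : nat) (t : C) :
  t * C_derive (fun s => s ^ n) t = RtoC (INR n) * t ^ n.
Proof.
  assert (H : exists l, cdiff (fun s => s ^ n) t l /\ t * l = RtoC (INR n) * t ^ n).
  { induction n as [|n [l [Hl E]]].
    - exists 0. split; [exact (cdiff_const 1 t)|simpl; ring].
    - exists (1 * t ^ n + t * l). split.
      + apply (cdiff_mult (f := fun s => s)); auto using cdiff_id.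
      + rewrite E, S_INR, RtoC_plus. simpl. ring. }
  destruct H as [l [Hl E]]. now rewrite (cdiff_derive Hl).
Qed.

(** The monomial t^e is an eigenvector of t d/dt with eigenvalue e, so the leading coefficient is
    multiplied by e. Keeping the factor t avoids the exponent e - 1, truncated at e = 0. *)
Lemma euler (f g : C -> C) (e : nat) :
  hol g -> near (fun t => f t = t ^ e * g t) ->
  exists p, hol p /\ p 0 = RtoC (INR e) * g 0 /\ near (fun t => t * D1 f t = t ^ e * p t).
Proof.
  intros Hg Hf. exists (fun t => RtoC (INR e) * g t + t * D1 g t). repeat split.
  - apply hol_plus; [now apply hol_scal|]. apply hol_mult; [apply hol_id|now apply hol_derive].
  - ring.
  - assert (Hp : hol (fun t => t ^ e)) by apply hol_pow, hol_id.
    refine (near_imp _ (near_and (derive_mult Hp Hg)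
              (derive_ext (hol_mult Hp Hg) (near_sym Hf)))).
    intros t [E1 E2]. rewrite E2, E1.
    replace (t * (C_derive (fun s => s ^ e) t * g t + t ^ e * D1 g t))
      with (t * C_derive (fun s => s ^ e) t * g t + t ^ e * (t * D1 g t)) by ring.
    rewrite pow_euler. ring.
Qed.

(* Iterating the Euler operator t d/dt, which preserves the factor t^e,
   expresses t^k f^(k) without negative exponents. *)
Lemma euler_derivs (f g : C -> C) (e : nat) :
  hol f -> hol g -> near (fun t => f t = t ^ e * g t) ->
  exists p q r, hol p /\ hol q /\ hol r /\
    p 0 = RtoC (INR e) * g 0 /\
    q 0 = RtoC (INR e) * (RtoC (INR e) - 1) * g 0 /\
    r 0 = RtoC (INR e) * (RtoC (INR e) - 1) * (RtoC (INR e) - 2) * g 0 /\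
    near (fun t => t * D1 f t = t ^ e * p t /\ t ^ 2 * D2 f t = t ^ e * q t /\
                   t ^ 3 * D3 f t = t ^ e * r t).
Proof.
  intros Hhf Hg Hf. destruct (hol_derivs Hhf) as [F1 [F2 F3]].
  destruct (euler Hg Hf) as [p [Hp [Ep Np]]].
  destruct (euler Hp Np) as [p2 [Hp2 [Ep2 Np2]]].
  destruct (euler Hp2 Np2) as [p3 [Hp3 [Ep3 Np3]]].
  (* With E = t d/dt, these are the identities t^2 d^2 = E^2 - E and t^3 d^3 = E^3 - 3 E^2 + 2 E
     read on cofactors. *)
  exists p, (fun t => p2 t - p t), (fun t => p3 t - 3 * p2 t + 2 * p t).
  repeat split; auto using hol_minus.
  - apply hol_plus; [apply hol_minus|]; auto using hol_scal.
  - rewrite Ep2, Ep. ring.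
  - rewrite Ep3, Ep2, Ep. ring.
  - set (h := fun t => t * D1 f t) in *.
    assert (Eh : near (fun t => D1 h t = D1 f t + t * D2 f t)).
    { refine (near_imp _ (derive_mult hol_id F1)). intros t E. unfold h.
      rewrite E, derive_id. ring. }
    assert (H1 : hol (fun t => D1 f t + t * D2 f t)).
    { apply hol_plus; auto. apply hol_mult; auto using hol_id. }
    assert (Hh : hol h) by (apply hol_mult; auto using hol_id).
    assert (Eh2 : near (fun t => D2 h t = 2 * D2 f t + t * D3 f t)).
    { refine (derive_trans Hh Eh _).
      refine (near_imp _ (near_and (derive_plus F1 (hol_mult hol_id F2)) (derive_mult hol_id F2))).
      intros t [E E']. rewrite E, E', derive_id. ring. }
    assert (Eh3 : near (fun t => C_derive (fun s => s * D1 h s) t = D1 h t + t * D2 h t)).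
    { refine (near_imp _ (derive_mult hol_id (hol_derive Hh))). intros t E.
      rewrite E, derive_id. ring. }
    refine (near_imp _ (near_and (near_and Np (near_and Np2 Np3)) (near_and Eh (near_and Eh2 Eh3)))).
    intros t [[A1 [A2 A3]] [B1 [B2 B3]]].
    rewrite B3, B2, B1 in A3. rewrite B1 in A2. unfold h in A1.
    split; [exact A1|]. split.
    + replace (t ^ e * (p2 t - p t)) with (t ^ e * p2 t - t ^ e * p t) by ring.
      rewrite <- A2, <- A1. ring.
    + replace (t ^ e * (p3 t - 3 * p2 t + 2 * p t))
        with (t ^ e * p3 t - 3 * (t ^ e * p2 t) + 2 * (t ^ e * p t)) by ring.
      rewrite <- A3, <- A2, <- A1. ring.
Qed.

Lemma has_order_div (f : C -> C) (j n : nat) :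
  hol f -> has_order (fun t => t ^ j * f t) n -> exists k, has_order f k /\ (n = j + k)%nat.
Proof.
  intros Hf Hn. destruct (order_cases Hf) as [H0|[k Hk]].
  - exfalso. apply (has_order_nonzero Hn). refine (near_imp _ H0). intros t ->; ring.
  - exists k. split; auto. apply (has_order_unique Hn). apply has_order_mult; auto.
    exists (fun _ => 1). repeat split; [apply hol_const|apply C1_nz|].
    apply near_all; intros t; ring.
Qed.

Lemma INR_C_nz (n : nat) : (0 < n)%nat -> RtoC (INR n) <> 0.
Proof. intros H E. apply RtoC_inj in E. revert E. apply not_0_INR. lia. Qed.

Lemma INR_C_minus_nz (m n : nat) : m <> n -> RtoC (INR m) - RtoC (INR n) <> 0.
Proof.
  intros H E. apply H, INR_eq, RtoC_inj.
  replace (RtoC (INR m)) with (RtoC (INR m) - RtoC (INR n) + RtoC (INR n)) by ring.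
  rewrite E; ring.
Qed.

Lemma ord_W2 (f g : C -> C) (a b : nat) :
  has_order f a -> has_order g b -> (0 < a)%nat -> (0 < b)%nat -> a <> b ->
  ord (W2 f g) = Finite (INR a + INR b - 3)%R.
Proof.
  intros Hf Hg a0 b0 ab.
  assert (Ff := has_order_hol Hf). assert (Gg := has_order_hol Hg).
  destruct Hf as [u [Hu [U0 Nu]]]. destruct Hg as [v [Hv [V0 Nv]]].
  destruct (euler_derivs Ff Hu Nu) as [p [q [r [Hp [Hq [Hr [Ep [Eq [Er N]]]]]]]]].
  destruct (euler_derivs Gg Hv Nv) as [p' [q' [r' [Hp' [Hq' [Hr' [Ep' [Eq' [Er' N']]]]]]]]].
  (* Every product in the determinant has one first and one second derivative, so t^3 serves both;
     the cofactor at 0 is ab(b - a) times the two leading coefficients. *)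
  assert (H : has_order (fun t => t ^ 3 * W2 f g t) (a + b)).
  { exists (fun t => p t * q' t - q t * p' t). repeat split.
    - apply hol_minus; now apply hol_mult.
    - rewrite Ep, Eq, Ep', Eq'.
      replace (_ - _) with
        (RtoC (INR a) * RtoC (INR b) * (RtoC (INR b) - RtoC (INR a)) * u 0 * v 0) by ring.
      repeat apply Cmult_neq_0; auto using INR_C_nz, INR_C_minus_nz.
    - refine (near_imp _ (near_and N N')). intros t [[A1 [A2 _]] [B1 [B2 _]]].
      rewrite Cpow_add_r.
      replace (t ^ a * t ^ b * (p t * q' t - q t * p' t))
        with ((t ^ a * p t) * (t ^ b * q' t) - (t ^ a * q t) * (t ^ b * p' t)) by ring.
      rewrite <- A1, <- A2, <- B1, <- B2. unfold W2. ring. }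
  destruct (has_order_div (hol_W2 Ff Gg) H) as [k [Hk Ek]].
  rewrite (ord_has_order Hk). f_equal.
  apply (f_equal INR) in Ek. rewrite !plus_INR in Ek. simpl in Ek. lra.
Qed.

(** The leading coefficient is the determinant with rows a, a(a - 1), a(a - 1)(a - 2) and likewise
    for b and c. Column operations turn the falling factorials into powers, leaving abc times a
    Vandermonde determinant. *)
Lemma ord_W3 (f g h : C -> C) (a b c : nat) :
  has_order f a -> has_order g b -> has_order h c ->
  (0 < a)%nat -> (0 < b)%nat -> (0 < c)%nat -> a <> b -> a <> c -> b <> c ->
  ord (W3 f g h) = Finite (INR a + INR b + INR c - 6)%R.
Proof.
  intros Hf Hg Hh a0 b0 c0 ab ac bc.
  assert (Ff := has_order_hol Hf). assert (Gg := has_order_hol Hg).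
  assert (Hhh := has_order_hol Hh).
  destruct Hf as [u [Hu [U0 Nu]]]. destruct Hg as [v [Hv [V0 Nv]]].
  destruct Hh as [w [Hw [W0 Nw]]].
  destruct (euler_derivs Ff Hu Nu) as [p [q [r [Hp [Hq [Hr [Ep [Eq [Er N]]]]]]]]].
  destruct (euler_derivs Gg Hv Nv) as [p' [q' [r' [Hp' [Hq' [Hr' [Ep' [Eq' [Er' N']]]]]]]]].
  destruct (euler_derivs Hhh Hw Nw) as [s [s' [s'' [Hs [Hs' [Hs'' [Es [Es' [Es'' N'']]]]]]]]].
  assert (H : has_order (fun t => t ^ 6 * W3 f g h t) (a + b + c)).
  { exists (fun t => p t * (q' t * s'' t - r' t * s' t) - q t * (p' t * s'' t - r' t * s t)
                     + r t * (p' t * s' t - q' t * s t)). repeat split.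
    - apply hol_plus; [apply hol_minus|]; apply hol_mult; auto;
        apply hol_minus; now apply hol_mult.
    - rewrite Ep, Eq, Er, Ep', Eq', Er', Es, Es', Es''.
      replace (_ + _) with
        (RtoC (INR a) * RtoC (INR b) * RtoC (INR c) * (RtoC (INR b) - RtoC (INR a))
          * (RtoC (INR c) - RtoC (INR a)) * (RtoC (INR c) - RtoC (INR b))
          * u 0 * v 0 * w 0) by ring.
      repeat apply Cmult_neq_0; auto using INR_C_nz, INR_C_minus_nz.
    - refine (near_imp _ (near_and N (near_and N' N''))).
      intros t [[A1 [A2 A3]] [[B1 [B2 B3]] [D1' [D2' D3']]]].
      rewrite !Cpow_add_r.
      match goal with |- _ = ?X => replace X with
        ((t ^ a * p t) * ((t ^ b * q' t) * (t ^ c * s'' t) - (t ^ b * r' t) * (t ^ c * s' t))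
         - (t ^ a * q t) * ((t ^ b * p' t) * (t ^ c * s'' t) - (t ^ b * r' t) * (t ^ c * s t))
         + (t ^ a * r t) * ((t ^ b * p' t) * (t ^ c * s' t) - (t ^ b * q' t) * (t ^ c * s t)))
        by ring end.
      rewrite <- A1, <- A2, <- A3, <- B1, <- B2, <- B3, <- D1', <- D2', <- D3'.
      unfold W3. ring. }
  destruct (has_order_div (hol_W3 Ff Gg Hhh) H) as [k [Hk Ek]].
  rewrite (ord_has_order Hk). f_equal.
  apply (f_equal INR) in Ek. rewrite !plus_INR in Ek. simpl in Ek. lra.
Qed.

Lemma W2_zero (f g : C -> C) : zero_germ g -> zero_germ (W2 f g).
Proof.
  intros H. refine (near_imp _ (zero_germ_derivs H)). intros t [E1 [E2 E3]].
  unfold W2. rewrite E1, E2. ring.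
Qed.

Lemma W3_zero_2 (f g h : C -> C) : zero_germ g -> zero_germ (W3 f g h).
Proof.
  intros H. refine (near_imp _ (zero_germ_derivs H)). intros t [E1 [E2 E3]].
  unfold W3. rewrite E1, E2, E3. ring.
Qed.

Lemma W3_zero_3 (f g h : C -> C) : zero_germ h -> zero_germ (W3 f g h).
Proof.
  intros H. refine (near_imp _ (zero_germ_derivs H)). intros t [E1 [E2 E3]].
  unfold W3. rewrite E1, E2, E3. ring.
Qed.

Lemma W2_lincomb (p q r s : C) (f g : C -> C) : hol f -> hol g ->
  near (fun t => W2 (lincomb p q f g) (lincomb r s f g) t = (p * s - q * r) * W2 f g t).
Proof.
  intros Hf Hg.
  refine (near_imp _ (near_and (derivs_lincomb p q Hf Hg) (derivs_lincomb r s Hf Hg))).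
  intros t [[A1 [A2 _]] [B1 [B2 _]]]. unfold W2. rewrite A1, A2, B1, B2. ring.
Qed.

Lemma W3_lincomb (p q r s : C) (f g h : C -> C) : hol f -> hol g ->
  near (fun t => W3 (lincomb p q f g) (lincomb r s f g) h t = (p * s - q * r) * W3 f g h t).
Proof.
  intros Hf Hg.
  refine (near_imp _ (near_and (derivs_lincomb p q Hf Hg) (derivs_lincomb r s Hf Hg))).
  intros t [[A1 [A2 A3]] [B1 [B2 B3]]]. unfold W3. rewrite A1, A2, A3, B1, B2, B3. ring.
Qed.

(** Nested [lincomb]s let [derivs_lincomb] compute its derivatives in two steps; [al] and [be] stand
    for 2B and 2C. *)
Definition pencil (A al be : C) (x y : C -> C) : C -> C :=
  lincomb A 1 (sqnorm x y) (lincomb al be x y).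

(** The linear part is a combination of the other two entries and drops out of the determinant. Any
    circle may therefore be used to compute v, and later proofs pick the one of suitable order. *)
Lemma W3_pencil (A al be : C) (x y : C -> C) : hol x -> hol y ->
  near (fun t => W3 x y (pencil A al be x y) t = -2 * A * v_germ x y t).
Proof.
  intros Hx Hy.
  refine (near_imp _ (near_and (derivs_lincomb A 1 (hol_sqnorm Hx Hy) (hol_lincomb al be Hx Hy))
            (near_and (derivs_lincomb al be Hx Hy) (derivs_sqnorm Hx Hy)))).
  intros t [[A1 [A2 A3]] [[B1 [B2 B3]] [E1 [E2 E3]]]].
  unfold W3, pencil, v_germ. simpl C_derive_n.
  rewrite A1, A2, A3, B1, B2, B3, E1, E2, E3. ring.
Qed.

Lemma has_order_pos (f : C -> C) (k : nat) : has_order f k -> f 0 = 0 -> (0 < k)%nat.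
Proof.
  intros [g [_ [G0 E]]] F0. destruct k; [|lia]. exfalso. apply G0.
  apply near_0 in E. simpl in E. rewrite Cmult_1_l in E. now rewrite <- E.
Qed.

Lemma ord_eqfun (f g : C -> C) : hol f -> (forall t, f t = g t) -> ord f = ord g.
Proof. intros Hf H. apply ord_ext; auto. now apply near_all. Qed.

Lemma has_order_eqfun (f g : C -> C) (k : nat) :
  (forall t, f t = g t) -> has_order f k -> has_order g k.
Proof. intros H. apply has_order_ext. now apply near_all. Qed.

Lemma Rbar_trichotomy (a b : Rbar) : Rbar_lt a b \/ a = b \/ Rbar_lt b a.
Proof. destruct (Rbar_total_order a b) as [[H|H]|H]; auto. Qed.

(** * The pencil of circles and lines *)

(** Whichever of x and y has the smaller order comes first; at equal orders the second is reduced by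
    the first. The second element may end up zero, when x and y are proportional. *)
Lemma adapted_basis (x y : C -> C) : hol x -> hol y -> ~ (zero_germ x /\ zero_germ y) ->
  exists p q r s e, p * s - q * r <> 0 /\ has_order (lincomb p q x y) e /\
    Rbar_lt (INR e) (ord (lincomb r s x y)).
Proof.
  intros Hx Hy H.
  assert (L1 : forall t, x t = lincomb 1 0 x y t) by (intros t; unfold lincomb; ring).
  assert (L2 : forall t, y t = lincomb 0 1 x y t) by (intros t; unfold lincomb; ring).
  assert (Swap : forall e, has_order y e -> Rbar_lt (INR e) (ord x) ->
    exists p q r s e, p * s - q * r <> 0 /\ has_order (lincomb p q x y) e /\
    Rbar_lt (INR e) (ord (lincomb r s x y))).
  { intros e He Hlt. exists 0, 1, 1, 0, e. repeat split.
    - intros E. apply C1_nz. transitivity (- (0 * 0 - 1 * 1)); [ring|rewrite E; ring].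
    - exact (has_order_eqfun L2 He).
    - now rewrite <- (ord_eqfun Hx L1). }
  destruct (order_cases Hx) as [X0|[e He]].
  - destruct (order_cases Hy) as [Y0|[e He]]; [tauto|].
    apply (Swap e He). rewrite (ord_zero X0). exact I.
  - assert (E := ord_has_order He).
    destruct (Rbar_trichotomy (INR e) (ord y)) as [Hlt|[Heq|Hgt]].
    + exists 1, 0, 0, 1, e. repeat split.
      * intros E'. apply C1_nz. rewrite <- E'. ring.
      * exact (has_order_eqfun L1 He).
      * now rewrite <- (ord_eqfun Hy L2).
    + destruct (reduce_order He Hy (eq_sym Heq)) as [c Hc].
      exists 1, 0, c, 1, e. repeat split.
      * intros E'. apply C1_nz. rewrite <- E'. ring.
      * exact (has_order_eqfun L1 He).
      * rewrite <- (ord_eqfun (f := fun t => y t + c * x t)); auto.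
        -- apply hol_plus; auto. now apply hol_scal.
        -- intros t; unfold lincomb; ring.
    + destruct (order_cases Hy) as [Y0|[k Hk]].
      * rewrite (ord_zero Y0) in Hgt. destruct Hgt.
      * apply (Swap k Hk). rewrite E. now rewrite (ord_has_order Hk) in Hgt.
Qed.

(** First order e is removed with [f1], then the order of [f2] with [f2]. The second correction
    cannot bring e back, since it produces an order beyond that of [f2], already larger than e.
    Nothing can be removed if [f2] is zero, whence the escape clause. *)
Lemma reduced_third (f1 f2 u : C -> C) (e : nat) : hol u -> hol f2 ->
  has_order f1 e -> Rbar_lt (INR e) (ord f2) ->
  exists c d, let w := fun t => u t + lincomb c d f1 f2 t in
    ord w <> INR e /\ (ord w = ord f2 -> ord w = p_infty).
Proof.
  intros Hu H2 H1 He. assert (F1 := has_order_hol H1).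
  assert (S : exists c, ord (fun t => u t + c * f1 t) <> INR e).
  { destruct (classic (ord u = INR e)) as [E|E].
    - destruct (reduce_order H1 Hu E) as [c Hc]. exists c. intros E'. rewrite E' in Hc.
      simpl in Hc. lra.
    - exists 0. rewrite <- (ord_eqfun Hu); auto. intros t; ring. }
  destruct S as [c Hc]. exists c.
  assert (Hw : hol (fun t => u t + c * f1 t)) by (apply hol_plus; auto using hol_scal).
  set (w1 := fun t => u t + c * f1 t) in *.
  assert (Ew : forall d, ord (fun t => u t + lincomb c d f1 f2 t) = ord (fun t => w1 t + d * f2 t)).
  { intros d. symmetry. apply ord_eqfun.
    - apply hol_plus; auto using hol_scal.
    - intros t; unfold w1, lincomb; ring. }
  destruct (order_cases H2) as [Z2|[k Hk]].
  - exists 0. cbv zeta. rewrite Ew, (ord_zero Z2). split; auto.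
    rewrite <- (ord_eqfun Hw); auto. intros t; ring.
  - destruct (classic (ord w1 = INR k)) as [E|E].
    + destruct (reduce_order Hk Hw E) as [d Hd]. exists d. cbv zeta. rewrite Ew.
      rewrite (ord_has_order Hk) in *. split; intros E'; rewrite E' in Hd; simpl in *; lra.
    + exists 0. cbv zeta. rewrite Ew, (ord_has_order Hk).
      rewrite <- (ord_eqfun Hw (g := fun t => w1 t + 0 * f2 t)) by (intros t; ring).
      split; auto. tauto.
Qed.

Lemma ord_lincomb (f1 f2 : C -> C) (e : nat) (a b : C) :
  hol f2 -> has_order f1 e -> Rbar_lt (INR e) (ord f2) -> ~ (a = 0 /\ b = 0) ->
  ord (lincomb a b f1 f2) = INR e \/ ord (lincomb a b f1 f2) = ord f2.
Proof.
  intros H2 H1 He Hab. assert (F1 := has_order_hol H1).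
  destruct (Ceq_dec a 0) as [->|Ha].
  - assert (Hb : b <> 0) by tauto. right. rewrite <- (ord_scal H2 Hb).
    symmetry. apply ord_eqfun; [now apply hol_scal|]. intros t; unfold lincomb; ring.
  - left. rewrite <- (ord_has_order H1), <- (ord_scal F1 Ha).
    destruct (Ceq_dec b 0) as [->|Hb].
    + symmetry. apply ord_eqfun; [now apply hol_scal|]. intros t; unfold lincomb; ring.
    + apply ord_plus_lt; try now apply hol_scal.
      now rewrite (ord_scal F1 Ha), (ord_scal H2 Hb), (ord_has_order H1).
Qed.

(** Nonzero combinations of [f1] and [f2] have only two possible orders, both avoided by [w], so no
    leading terms can cancel and a sum has the smaller order. A coincidence happens only at
    infinity, where [w] is trivially maximal. *)
Lemma ord_reduced_max (f1 f2 w : C -> C) (e : nat) (a b : C) :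
  hol f2 -> hol w -> has_order f1 e -> Rbar_lt (INR e) (ord f2) ->
  ord w <> INR e -> (ord w = ord f2 -> ord w = p_infty) ->
  Rbar_le (ord (fun t => w t + lincomb a b f1 f2 t)) (ord w).
Proof.
  intros H2 Hw H1 He Hwe Hwf. assert (F1 := has_order_hol H1).
  assert (Hs := hol_lincomb a b F1 H2).
  destruct (classic (a = 0 /\ b = 0)) as [[-> ->]|Hab].
  - rewrite <- (ord_eqfun Hw); [apply Rbar_le_refl|]. intros t; unfold lincomb; ring.
  - destruct (Rbar_trichotomy (ord w) (ord (lincomb a b f1 f2))) as [H|[H|H]].
    + rewrite (ord_plus_lt Hw Hs H). apply Rbar_le_refl.
    + destruct (ord_lincomb H2 H1 He Hab) as [E|E]; rewrite E in H; [tauto|].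
      rewrite (Hwf H). destruct (ord (fun t => w t + lincomb a b f1 f2 t)); exact I.
    + rewrite (ord_eqfun (g := fun t => lincomb a b f1 f2 t + w t)).
      * rewrite (ord_plus_lt Hs Hw H). now apply Rbar_lt_le.
      * now apply hol_plus.
      * intros t; ring.
Qed.

Lemma hol_pencil (A al be : C) (x y : C -> C) : hol x -> hol y -> hol (pencil A al be x y).
Proof. intros Hx Hy. apply hol_lincomb; [now apply hol_sqnorm|now apply hol_lincomb]. Qed.

Lemma contact_pencil (x y : C -> C) (G : circle_or_line) : hol x -> hol y ->
  contact x y G = ord (pencil (cA G) (2 * cB G) (2 * cC G) x y).
Proof.
  intros Hx Hy. symmetry. apply ord_eqfun; [now apply hol_pencil|].
  intros t. unfold pencil, lincomb, sqnorm. ring.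
Qed.

(* [lincomb p q] and [lincomb r s] span the lines and [pencil 1 ga de] completes them
   to a basis of the circles in which the three orders of contact are distinct, except
   that two of them may both be infinite. *)
Lemma adapted_pencil (x y : C -> C) : hol x -> hol y -> ~ (zero_germ x /\ zero_germ y) ->
  exists p q r s e ga de, p * s - q * r <> 0 /\ has_order (lincomb p q x y) e /\
    Rbar_lt (INR e) (ord (lincomb r s x y)) /\
    ord (pencil 1 ga de x y) <> INR e /\
    (ord (pencil 1 ga de x y) = ord (lincomb r s x y) -> ord (pencil 1 ga de x y) = p_infty) /\
    (forall A al be : C, A <> 0 -> Rbar_le (ord (pencil A al be x y)) (ord (pencil 1 ga de x y))) /\
    (forall al be : C, ~ (al = 0 /\ be = 0) ->
       Rbar_le (ord (lincomb al be x y)) (ord (lincomb r s x y))).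
Proof.
  intros Hx Hy H. destruct (adapted_basis Hx Hy H) as [p [q [r [s [e [Hd [H1 He]]]]]]].
  set (f1 := lincomb p q x y) in *. set (f2 := lincomb r s x y) in *.
  assert (F1 := has_order_hol H1). assert (H2 : hol f2) by now apply hol_lincomb.
  destruct (reduced_third (hol_sqnorm Hx Hy) H2 H1 He) as [c [d [Hw1 Hw2]]].
  set (w := fun t => _) in Hw1, Hw2.
  assert (Hw : hol w) by (apply hol_plus; [now apply hol_sqnorm|now apply hol_lincomb]).
  (* The last two are the coordinates of [lincomb c d f1 f2] with respect to x and y. *)
  exists p, q, r, s, e, (c * p + d * r), (c * q + d * s).
  assert (Ew : ord (pencil 1 (c * p + d * r) (c * q + d * s) x y) = ord w).
  { apply ord_eqfun; [now apply hol_pencil|].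
    intros t. unfold w, f1, f2, pencil, lincomb. ring. }
  rewrite Ew. fold f1 f2. repeat split; auto.
  - intros A al be HA.
    (* After division by A, what remains beside [w] is the linear form with coefficients [a] and
       [b]; Cramer's rule rewrites it in [f1] and [f2]. *)
    pose (a := (al / A - (c * p + d * r)) ). pose (b := (be / A - (c * q + d * s))).
    rewrite (ord_eqfun (g := fun t => A * (w t
       + lincomb ((a * s - b * r) / (p * s - q * r)) ((b * p - a * q) / (p * s - q * r)) f1 f2 t))).
    + set (s1 := lincomb _ _ f1 f2).
      assert (Hs1 : hol (fun t => w t + s1 t)) by (apply hol_plus; auto; now apply hol_lincomb).
      rewrite (ord_scal Hs1 HA). now apply (ord_reduced_max _ _ H2 Hw H1 He).
    + now apply hol_pencil.
    + intros t. unfold w, f1, f2, pencil, lincomb, a, b. field. auto.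
  - intros al be Hab.
    rewrite (ord_eqfun (g := lincomb ((al * s - be * r) / (p * s - q * r))
                               ((be * p - al * q) / (p * s - q * r)) f1 f2)).
    + destruct (ord_lincomb H2 H1 He (a := (al * s - be * r) / (p * s - q * r))
                               (b := (be * p - al * q) / (p * s - q * r))) as [->| ->].
      * intros [Ea Eb]. apply Hab. split.
        -- replace al with ((al * s - be * r) / (p * s - q * r) * p
              + (be * p - al * q) / (p * s - q * r) * r) by (field; auto).
           rewrite Ea, Eb. ring.
        -- replace be with ((al * s - be * r) / (p * s - q * r) * q
              + (be * p - al * q) / (p * s - q * r) * s) by (field; auto).
           rewrite Ea, Eb. ring.
      * now apply Rbar_lt_le.
      * apply Rbar_le_refl.
    + now apply hol_lincomb.
    + intros t. unfold f1, f2, lincomb. field. auto.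
Qed.

(** * Existence of osculating curves and the relation between V, I and lambda *)

Lemma double_nz (c : C) : 2 * c = 0 -> c = 0.
Proof.
  intros H. replace c with (/ 2 * (2 * c)) by (field; intros E; apply RtoC_inj in E; lra).
  rewrite H; ring.
Qed.

Lemma circle_exists (al be : C) (x y : C -> C) : hol x -> hol y ->
  exists G, is_circle G /\ contact x y G = ord (pencil 1 al be x y).
Proof.
  intros Hx Hy.
  exists (@CircleOrLine 1 (al / 2) (be / 2) (fun h => C1_nz (proj1 h))).
  split; [exact C1_nz|]. rewrite contact_pencil; auto. simpl.
  f_equal. f_equal; field; intros E; apply RtoC_inj in E; lra.
Qed.

Lemma line_exists (al be : C) (x y : C -> C) : hol x -> hol y -> ~ (al = 0 /\ be = 0) ->
  exists G, is_line G /\ cB G = al /\ cC G = be /\ contact x y G = ord (lincomb al be x y).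
Proof.
  intros Hx Hy H.
  exists (@CircleOrLine 0 al be (fun h => H (proj2 h))).
  repeat split. rewrite contact_pencil; auto. simpl.
  assert (H2 : (2 : C) <> 0) by (intros E; apply RtoC_inj in E; lra).
  rewrite <- (ord_scal (hol_lincomb al be Hx Hy) H2).
  apply ord_eqfun; [now apply hol_pencil|].
  intros t. unfold pencil, lincomb. ring.
Qed.

Lemma contact_line (x y : C -> C) (G : circle_or_line) : hol x -> hol y -> is_line G ->
  contact x y G = ord (lincomb (cB G) (cC G) x y).
Proof.
  intros Hx Hy HG. rewrite contact_pencil; auto. red in HG. rewrite HG.
  assert (H2 : (2 : C) <> 0) by (intros E; apply RtoC_inj in E; lra).
  rewrite <- (ord_scal (hol_lincomb (cB G) (cC G) Hx Hy) H2).
  apply ord_eqfun; [now apply hol_pencil|].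
  intros t. unfold pencil, lincomb. ring.
Qed.

Lemma lambda_exists (x y : C -> C) (ga de : C) : hol x -> hol y ->
  (forall A al be : C, A <> 0 -> Rbar_le (ord (pencil A al be x y)) (ord (pencil 1 ga de x y))) ->
  is_lambda x y (ord (pencil 1 ga de x y)).
Proof.
  intros Hx Hy H. split; [now apply circle_exists|].
  intros G HG. rewrite contact_pencil; auto.
Qed.

(** The best circle [K] and the best line [L] are both attained by [adapted_pencil]; the better of
    the two is osculating. *)
Lemma osculating_exists (x y : C -> C) : hol x -> hol y -> ~ (zero_germ x /\ zero_germ y) ->
  exists G, osculating x y G.
Proof.
  intros Hx Hy H.
  destruct (adapted_pencil Hx Hy H)
    as [p [q [r [s [e [ga [de [Hd [H1 [He [Hw1 [Hw2 [Hc Hl]]]]]]]]]]]]].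
  destruct (circle_exists ga de Hx Hy) as [K [_ EK]].
  destruct (@line_exists r s x y Hx Hy) as [L [_ [_ [_ EL]]]].
  { intros [-> ->]. apply Hd. ring. }
  assert (B : forall G, Rbar_le (contact x y G) (contact x y K) \/
                        Rbar_le (contact x y G) (contact x y L)).
  { intros G. destruct (Ceq_dec (cA G) 0) as [E|E].
    - right. rewrite (contact_line Hx Hy E), EL. apply Hl.
      intros [E1 E2]. exact (c_nonzero (conj E (conj E1 E2))).
    - left. rewrite contact_pencil, EK; auto. }
  destruct (Rbar_le_lt_dec (contact x y K) (contact x y L)) as [HKL|HKL].
  - exists L. intros G. destruct (B G) as [HG|HG]; auto. eapply Rbar_le_trans; eauto.
  - exists K. intros G. destruct (B G) as [HG|HG]; auto. apply Rbar_lt_le in HKL.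
    eapply Rbar_le_trans; eauto.
Qed.

Lemma V_ord_pencil (x y : C -> C) (A al be : C) : hol x -> hol y -> A <> 0 ->
  V_ord x y = ord (W3 x y (pencil A al be x y)).
Proof.
  intros Hx Hy HA.
  assert (Hv : hol (v_germ x y)).
  { apply (hol_ext (f := fun t => (-1 / 2) * W3 x y (pencil 1 0 0 x y) t)).
    - refine (near_imp _ (W3_pencil 1 0 0 Hx Hy)). intros t ->. field.
    - apply hol_scal, hol_W3; auto. now apply hol_pencil. }
  assert (Hc : -2 * A <> 0).
  { apply Cmult_neq_0; auto. intros E; apply RtoC_inj in E; lra. }
  unfold V_ord. rewrite <- (ord_scal Hv Hc). symmetry. apply ord_ext.
  - apply hol_W3; auto. now apply hol_pencil.
  - apply W3_pencil; auto.
Qed.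

Lemma V_I_lambda (x y : C -> C) : hol x -> hol y -> x 0 = 0 -> y 0 = 0 ->
  ~ (zero_germ x /\ zero_germ y) ->
  exists lam, is_lambda x y lam /\
    V_ord x y = Rbar_minus (Rbar_plus (I_ord x y) lam) (Finite 3).
Proof.
  intros Hx Hy X0 Y0 H.
  destruct (adapted_pencil Hx Hy H)
    as [p [q [r [s [e [ga [de [Hd [H1 [He [Hw1 [Hw2 [Hc Hl]]]]]]]]]]]]].
  exists (ord (pencil 1 ga de x y)). split; [now apply lambda_exists|].
  set (f1 := lincomb p q x y) in *. set (f2 := lincomb r s x y) in *.
  set (w := pencil 1 ga de x y) in *.
  assert (H2 : hol f2) by now apply hol_lincomb.
  assert (Hw : hol w) by now apply hol_pencil.
  assert (EI : I_ord x y = ord (W2 f1 f2)).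
  { transitivity (ord (fun t => (p * s - q * r) * W2 x y t)).
    - symmetry. apply ord_scal; auto. now apply hol_W2.
    - symmetry. apply ord_ext; [apply hol_W2; auto; now apply hol_lincomb|].
      now apply W2_lincomb. }
  assert (EV : V_ord x y = ord (W3 f1 f2 w)).
  { rewrite (V_ord_pencil ga de Hx Hy C1_nz). fold w.
    transitivity (ord (fun t => (p * s - q * r) * W3 x y w t)).
    - symmetry. apply ord_scal; auto. now apply hol_W3.
    - symmetry. apply ord_ext; [apply hol_W3; auto; now apply hol_lincomb|].
      now apply W3_lincomb. }
  assert (Z1 : f1 0 = 0) by (unfold f1, lincomb; rewrite X0, Y0; ring).
  assert (Z2 : f2 0 = 0) by (unfold f2, lincomb; rewrite X0, Y0; ring).
  assert (Z3 : w 0 = 0) by (unfold w, pencil, lincomb, sqnorm; rewrite X0, Y0; ring).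
  rewrite EI, EV.
  (* If [f2] is zero, both Wronskians vanish and both sides are [p_infty], whatever the order of
     [w]. If all three orders are finite, the identity is e + b + c - 6 = (e + b - 3) + c - 3. *)
  destruct (order_cases H2) as [E2|[b Hb]].
  - rewrite (ord_zero (W2_zero f1 E2)), (ord_zero (W3_zero_2 f1 w E2)).
    destruct (order_cases Hw) as [E3|[c Hcc]].
    + now rewrite (ord_zero E3).
    + now rewrite (ord_has_order Hcc).
  - rewrite (ord_has_order Hb) in He. simpl in He. apply INR_lt in He.
    assert (e0 := has_order_pos H1 Z1). assert (b0 := has_order_pos Hb Z2).
    rewrite (ord_W2 H1 Hb) by lia.
    destruct (order_cases Hw) as [E3|[c Hcc]].
    + rewrite (ord_zero E3). now rewrite (ord_zero (W3_zero_3 f1 f2 E3)).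
    + assert (c0 := has_order_pos Hcc Z3).
      rewrite (ord_has_order Hcc), (ord_has_order Hb) in *.
      assert (ec : e <> c) by (intros <-; auto).
      assert (bc : b <> c) by (intros <-; discriminate (Hw2 eq_refl)).
      rewrite (ord_W3 H1 Hb Hcc) by lia. simpl. f_equal. lra.
Qed.

(** * Non-injectivity at a critical point *)

Lemma geometric_half (c : R) : is_series (fun n => c * (1 / 2) ^ n)%R (2 * c)%R.
Proof.
  replace (2 * c)%R with (c * / (1 - 1 / 2))%R by field.
  apply (is_series_scal c (fun n => (1 / 2) ^ n)%R).
  apply is_series_geom. rewrite Rabs_pos_eq; lra.
Qed.

(** Newton's iteration with the fixed slope c. Since F - cz has Lipschitz constant |c|/2, the value
    of F at least halves at each step; the steps, at most d/4, d/8, ..., sum to at most d/2 and stay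
    in the disc. *)
Lemma approximate_linear_zero (F : C -> C) (z0 c : C) (d : R) :
  c <> 0 -> (0 < d)%R ->
  (forall z w, (Cmod (z - z0)%C <= d)%R -> (Cmod (w - z0)%C <= d)%R ->
     (Cmod (F z - F w - c * (z - w)) <= Cmod c / 2 * Cmod (z - w)%C)%R) ->
  (Cmod (F z0) <= Cmod c * (d / 4))%R ->
  exists z, (Cmod (z - z0)%C <= d)%R /\ F z = 0.
Proof.
  intros Hc d0 HF H0. assert (c0 : (0 < Cmod c)%R) by now apply Cmod_gt_0.
  pose (zs := fun n => Nat.iter n (fun z => z - F z / c) z0).
  pose (D := fun n => - (F (zs n) / c)).
  assert (ES : forall n, zs (S n) = zs n + D n) by (intros n; reflexivity).
  assert (I : forall n, (Cmod (zs n - z0)%C <= d / 2 * (1 - (1 / 2) ^ n) /\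
                         Cmod (F (zs n)) <= Cmod c * (d / 4 * (1 / 2) ^ n))%R).
  { induction n as [|n [I1 I2]].
    - split; [|simpl; rewrite Rmult_1_r; exact H0].
      change (zs O) with z0. replace (z0 - z0) with (0 : C) by ring.
      rewrite Cmod_0. simpl. lra.
    - assert (HD : (Cmod (D n) <= d / 4 * (1 / 2) ^ n)%R).
      { unfold D. rewrite Cmod_opp, Cmod_div by auto.
        apply Rmult_le_reg_r with (Cmod c); auto.
        replace (Cmod (F (zs n)) / Cmod c * Cmod c)%R with (Cmod (F (zs n))) by (field; lra).
        lra. }
      assert (Hp : (0 < (1 / 2) ^ n)%R) by (apply pow_lt; lra).
      assert (Hz : (Cmod (zs (S n) - z0)%C <= d / 2 * (1 - (1 / 2) ^ S n))%R).
      { rewrite ES. replace (zs n + D n - z0) with ((zs n - z0) + D n) by ring.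
        eapply Rle_trans; [apply Cmod_triangle|]. simpl. lra. }
      split; auto.
      (* The step is chosen so that [c * D n] equals [- F (zs n)]; the new value is thus exactly the
         deviation from linearity. *)
      replace (F (zs (S n))) with (F (zs (S n)) - F (zs n) - c * (zs (S n) - zs n)).
      + eapply Rle_trans; [apply HF|].
        * assert (0 < (1 / 2) ^ S n)%R by (apply pow_lt; lra). nra.
        * nra.
        * rewrite ES. replace (zs n + D n - zs n) with (D n) by ring. simpl. nra.
      + rewrite ES. unfold D. field. auto. }
  assert (HD : forall n k, (Cmod (D (n + k)%nat) <= d / 4 * (1 / 2) ^ n * (1 / 2) ^ k)%R).
  { intros n k. destruct (I (n + k)%nat) as [_ I2].
    unfold D. rewrite Cmod_opp, Cmod_div by auto.
    apply Rmult_le_reg_r with (Cmod c); auto.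
    replace (Cmod (F (zs (n + k)%nat)) / Cmod c * Cmod c)%R with (Cmod (F (zs (n + k)%nat)))
      by (field; lra).
    rewrite pow_add in I2. lra. }
  destruct (C_series_of_abs (HD O)) as [L HL].
  { eexists. apply geometric_half. }
  assert (HT : forall n, C_series (fun k => D (n + k)%nat) (z0 + L - zs n)).
  { induction n as [|n IH].
    - refine (C_series_eq HL _). change (zs O) with z0. ring.
    - refine (C_series_eq (C_series_ext _ (C_series_tail IH)) _).
      + intros k. f_equal. lia.
      + rewrite ES, Nat.add_0_r. ring. }
  assert (HB : forall n, (Cmod (z0 + L - zs n)%C <= 2 * (d / 4 * (1 / 2) ^ n))%R).
  { intros n. assert (G := @geometric_half (d / 4 * (1 / 2) ^ n)%R).
    exact (C_series_bound (HT n) G (HD n)). }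
  assert (HL' : (Cmod (z0 + L - z0)%C <= d)%R).
  { assert (h := HB O). change (zs O) with z0 in h. simpl in h. lra. }
  exists (z0 + L). split; auto.
  apply Cmod_eq_0. apply Rle_antisym; [|apply Cmod_ge_0].
  apply le_epsilon. intros eps He.
  (* With the limit within (d/2) 2^-N of [zs N], its value is at most 3/2 |c| times that distance
     plus |c| (d/4) 2^-N, in total |c| d 2^-N. *)
  destruct (pow_lt_1_zero (1 / 2) (ltac:(rewrite Rabs_pos_eq; lra)) (eps / (Cmod c * d)))
    as [N HN]; [apply Rdiv_lt_0_compat; nra|].
  specialize (HN N (le_n N)). rewrite Rabs_pos_eq in HN by (apply pow_le; lra).
  destruct (I N) as [I1 I2]. assert (HBN := HB N).
  assert (Hp : (0 < (1 / 2) ^ N)%R) by (apply pow_lt; lra).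
  assert (HF' := HF (z0 + L) (zs N) HL' (ltac:(nra))).
  replace (F (z0 + L)) with ((F (z0 + L) - F (zs N) - c * (z0 + L - zs N))
    + (F (zs N) + c * (z0 + L - zs N))) by ring.
  eapply Rle_trans; [apply Cmod_triangle|].
  assert (H3 : (Cmod (F (zs N) + c * (z0 + L - zs N)) <=
            Cmod (F (zs N)) + Cmod c * Cmod (z0 + L - zs N)%C)%R).
  { eapply Rle_trans; [apply Cmod_triangle|]. rewrite Cmod_mult. lra. }
  assert (H4 : (Cmod c * d * (1 / 2) ^ N <= eps)%R).
  { apply Rmult_lt_compat_l with (r := (Cmod c * d)%R) in HN; [|nra].
    replace (Cmod c * d * (eps / (Cmod c * d)))%R with eps in HN by (field; lra). lra. }
  nra.
Qed.

(** The constant is the sum of the moduli of the derived series at half the radius, by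
    [pow_lipschitz] on each term. *)
Lemma hol_lipschitz (g : C -> C) : hol g ->
  exists s K : R, (0 < s)%R /\ (0 <= K)%R /\ forall a b, (Cmod a <= s)%R -> (Cmod b <= s)%R ->
    (Cmod (g a - g b)%C <= K * Cmod (a - b)%C)%R.
Proof.
  rewrite holomorphic_germ_iff. intros [c [r [r0 Hg]]].
  assert (Hs : (0 <= r / 2 < r)%R) by lra.
  destruct (abs_conv_series (dcoef_abs_conv (pow_series_abs_conv Hg)) Hs) as [K HK].
  assert (HL : forall a b, (Cmod a <= r / 2)%R -> (Cmod b <= r / 2)%R ->
    (Cmod (g a - g b)%C <= Cmod (a - b)%C * K)%R).
  { intros a b Ha Hb.
    assert (H : C_series (fun n => c n * a ^ n + -1 * (c n * b ^ n)) (g a + -1 * g b)).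
    { apply C_series_plus; [apply Hg; lra|]. apply C_series_scal, Hg; lra. }
    apply C_series_tail in H.
    assert (HK' := is_series_scal (Cmod (a - b)%C) _ K HK).
    eapply Rle_trans; [|refine (C_series_bound H HK' _)].
    - right. f_equal. simpl. ring.
    - intros n. change (scal ?p ?q) with (p * q)%R.
      replace (c (S n) * a ^ S n + -1 * (c (S n) * b ^ S n))
        with (c (S n) * (a ^ S n - b ^ S n)) by ring.
      unfold dcoef. rewrite !Cmod_mult, Cmod_R, Rabs_pos_eq by apply pos_INR.
      apply Rle_trans with (Cmod (c (S n)) * (INR (S n) * (r / 2) ^ n * Cmod (a - b)%C))%R.
      + apply Rmult_le_compat_l; [apply Cmod_ge_0|]. now apply pow_lipschitz.
      + right; ring. }
  exists (r / 2)%R, (Rmax K 0). split; [lra|]. split; [apply Rmax_r|].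
  intros a b Ha Hb. eapply Rle_trans; [apply HL; auto|].
  rewrite Rmult_comm. apply Rmult_le_compat_r; [apply Cmod_ge_0|apply Rmax_l].
Qed.

(** Strict differentiability: the bound concerns two moving points near z0, as the hypothesis of
    [approximate_linear_zero] requires. The derivative is described by z0 l = m z0^m to avoid the
    exponent m - 1. *)
Lemma pow_strict_derivative (z0 : C) (m : nat) :
  exists (l : C) (K : R), z0 * l = RtoC (INR m) * z0 ^ m /\ (0 <= K)%R /\
    forall z w, (Cmod (z - z0)%C <= 1)%R -> (Cmod (w - z0)%C <= 1)%R ->
      (Cmod (z ^ m - w ^ m - l * (z - w))
        <= K * (Cmod (z - z0)%C + Cmod (w - z0)%C) * Cmod (z - w)%C)%R.
Proof.
  induction m as [|m [l [K [El [K0 IH]]]]].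
  - exists 0, 0%R. split; [simpl; ring|]. split; [lra|]. intros z w _ _.
    replace (z ^ 0 - w ^ 0 - 0 * (z - w)) with (0 : C) by (simpl; ring). rewrite Cmod_0. lra.
  - exists (z0 ^ m + z0 * l), ((Cmod z0 + 1) * K + (Cmod l + 2 * K) + Cmod l)%R.
    assert (P0 := Cmod_ge_0 z0). assert (P1 := Cmod_ge_0 l).
    split. { rewrite El, S_INR, RtoC_plus. simpl. ring. }
    split; [nra|]. intros z w Hz Hw.
    replace (z ^ S m - w ^ S m - (z0 ^ m + z0 * l) * (z - w))
      with (z * (z ^ m - w ^ m - l * (z - w))
            + (((w ^ m - z0 ^ m - l * (w - z0)) + l * (w - z0)) + (z - z0) * l) * (z - w))
      by (simpl; ring).
    assert (Hz' : (Cmod z <= Cmod z0 + 1)%R).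
    { replace z with (z0 + (z - z0)) by ring. eapply Rle_trans; [apply Cmod_triangle|]. lra. }
    assert (H1 := IH z w Hz Hw).
    assert (H2 := IH w z0 Hw). replace (z0 - z0) with (0 : C) in H2 by ring.
    rewrite Cmod_0 in H2. specialize (H2 ltac:(lra)).
    assert (Pz := Cmod_ge_0 (z - z0)). assert (Pw := Cmod_ge_0 (w - z0)).
    assert (Pzw := Cmod_ge_0 (z - w)).
    set (U := z ^ m - w ^ m - l * (z - w)) in *.
    set (V := w ^ m - z0 ^ m - l * (w - z0)) in *.
    assert (HV : (Cmod ((V + l * (w - z0)) + (z - z0) * l) <=
       (Cmod l + 2 * K) * Cmod (w - z0)%C + Cmod l * Cmod (z - z0)%C)%R).
    { eapply Rle_trans; [apply Cmod_triangle|].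
      eapply Rle_trans; [apply Rplus_le_compat_r, Cmod_triangle|].
      rewrite !Cmod_mult.
      assert (HV' : (K * (Cmod (w - z0)%C + 0) * Cmod (w - z0)%C <= K * Cmod (w - z0)%C * 1)%R).
      { rewrite Rplus_0_r. apply Rmult_le_compat_l; auto. now apply Rmult_le_pos. }
      assert (0 <= K * Cmod (w - z0)%C)%R by now apply Rmult_le_pos. lra. }
    eapply Rle_trans; [apply Cmod_triangle|]. rewrite !Cmod_mult.
    assert (HU : (Cmod z * Cmod U <= (Cmod z0 + 1) * (K * (Cmod (z - z0)%C + Cmod (w - z0)%C)
                    * Cmod (z - w)%C))%R).
    { apply Rmult_le_compat; auto using Cmod_ge_0. }
    apply Rle_trans with ((Cmod z0 + 1) * (K * (Cmod (z - z0)%C + Cmod (w - z0)%C)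
                    * Cmod (z - w)%C)
       + ((Cmod l + 2 * K) * Cmod (w - z0)%C + Cmod l * Cmod (z - z0)%C) * Cmod (z - w)%C)%R.
    + apply Rplus_le_compat; auto. apply Rmult_le_compat_r; auto.
    + rewrite <- !Rmult_assoc, <- Rmult_plus_distr_r. apply Rmult_le_compat_r; auto. nra.
Qed.

Lemma root_of_unity (m : nat) : (2 <= m)%nat ->
  exists z : C, z ^ m = 1 /\ z <> 1 /\ Cmod z = 1%R.
Proof.
  intros Hm. pose (th := (2 * PI / INR m)%R).
  assert (Hm' : (2 <= INR m)%R) by (change 2%R with (INR 2); now apply le_INR).
  assert (DM : forall n, (cos th, sin th) ^ n = (cos (INR n * th), sin (INR n * th)) :> C).
  { induction n as [|n IH].
    - simpl. now rewrite Rmult_0_l, cos_0, sin_0.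
    - rewrite Cpow_S, IH, S_INR, Rmult_plus_distr_r, Rmult_1_l, cos_plus, sin_plus.
      unfold Cmult. simpl. f_equal; ring. }
  exists (cos th, sin th). split; [|split].
  - rewrite DM. unfold th. replace (INR m * (2 * PI / INR m))%R with (2 * PI)%R by (field; lra).
    now rewrite cos_2PI, sin_2PI.
  - intros E. injection E as E _.
    assert (Hp := PI_RGT_0).
    assert (T0 : (0 < th)%R) by (apply Rdiv_lt_0_compat; lra).
    (* This is where m >= 2 enters: on (0, PI] the cosine is below 1, so the root differs from 1. *)
    assert (T1 : (th <= PI)%R).
    { unfold th. apply Rmult_le_reg_r with (INR m); [lra|].
      replace (2 * PI / INR m * INR m)%R with (2 * PI)%R by (field; lra). nra. }
    assert (Hc := cos_decreasing_1 0 th). rewrite cos_0 in Hc. lra.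
  - unfold Cmod. simpl fst; simpl snd.
    replace (cos th ^ 2 + sin th ^ 2)%R with 1%R; [apply sqrt_1|].
    assert (Hs := sin2_cos2 th). unfold Rsqr in Hs. simpl. lra.
Qed.

Lemma mult_small (K e : R) : (0 <= K)%R -> (0 < e)%R -> exists d, (0 < d)%R /\ (K * d <= e)%R.
Proof.
  intros HK He. exists (e / (K + 1))%R. split; [apply Rdiv_lt_0_compat; lra|].
  apply Rle_trans with ((K + 1) * (e / (K + 1)))%R; [|right; field; lra].
  apply Rmult_le_compat_r; [|lra]. apply Rlt_le, Rdiv_lt_0_compat; lra.
Qed.

(* Writing f = t^m g and s = t z, the equation f(s) = f(t) becomes z^m g(t z) = g(t),
   which for small t is solvable near any m-th root of unity. *)
Lemma not_injective_of_order (f : C -> C) (m : nat) (r : R) :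
  has_order f m -> (2 <= m)%nat -> (0 < r)%R ->
  exists s t, (0 < Cmod s < r)%R /\ (0 < Cmod t < r)%R /\ s <> t /\ f s = f t.
Proof.
  intros [g [Hg [G0 Nf]]] Hm r0.
  destruct (root_of_unity Hm) as [ze [Z1 [Z2 Z3]]].
  destruct (pow_strict_derivative ze m) as [l [Kp [El [Kp0 Hp]]]].
  destruct (hol_lipschitz Hg) as [s0 [Kg [s00 [Kg0 HgL]]]].
  apply near_iff in Nf. destruct Nf as [r1 [r10 Hf]].
  (* The derivative at [ze] of z^m g(0), the limit of z^m g(tz) as t tends to 0; it is the slope of
     the iteration. *)
  pose (c := l * g 0).
  assert (Hl : l <> 0).
  { intros E. rewrite E, Z1 in El. apply (INR_C_nz (n := m)); [lia|].
    transitivity (ze * 0); [rewrite El|]; ring. }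
  assert (Hc : c <> 0) by now apply Cmult_neq_0.
  assert (c0 : (0 < Cmod c)%R) by now apply Cmod_gt_0.
  assert (l0 := Cmod_ge_0 l). assert (g0 := Cmod_ge_0 (g 0)).
  assert (zd : (0 < Cmod (ze - 1))%R).
  { apply Cmod_gt_0. intros E. apply Z2. transitivity (ze - 1 + 1); [ring|rewrite E; ring]. }
  pose (M := (Cmod (g 0) + Kg * s0)%R). assert (M0 : (0 <= M)%R) by (unfold M; nra).
  destruct (@mult_small (2 * Kp * M) (Cmod c / 4)) as [d1 [d10 Hd1]]; [nra|lra|].
  (* [d1] limits the nonlinearity of z^m to |c|/4, the bound 1/2 keeps |z| between 1/2 and 2, and
     the last one keeps 1 out of the disc, so that tz differs from t. *)
  pose (d := Rmin d1 (Rmin (1 / 2) (Cmod (ze - 1)%C / 2))).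
  assert (d0 : (0 < d)%R) by (unfold d; repeat apply Rmin_glb_lt; lra).
  assert (dd1 : (d <= d1)%R) by apply Rmin_l.
  assert (dh : (d <= 1 / 2)%R) by (eapply Rle_trans; [apply Rmin_r|apply Rmin_l]).
  assert (dz : (d < Cmod (ze - 1)%C)%R).
  { eapply Rle_lt_trans; [eapply Rle_trans; [apply Rmin_r|apply Rmin_r]|lra]. }
  assert (P2 : (0 < 2 ^ m)%R) by (apply pow_lt; lra).
  destruct (@mult_small (Cmod l * (2 * Kg) + 2 ^ m * Kg) (Cmod c / 4)) as [t1 [t10 Ht1]];
    [nra|lra|].
  destruct (@mult_small (2 * Kg) (Cmod c * (d / 4))) as [t2 [t20 Ht2]]; [nra|nra|].
  (* [t1] limits the variation of g to another |c|/4, [t2] makes the value at the starting point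
     [ze] small enough, and the rest keeps t and tz, with |z| <= 2, in the discs where the estimates
     and the factorisation hold. *)
  pose (tau := Rmin (Rmin t1 t2) (Rmin (s0 / 2) (Rmin (r / 4) (r1 / 4)))).
  assert (T0 : (0 < tau)%R) by (unfold tau; repeat apply Rmin_glb_lt; lra).
  assert (Tt1 : (tau <= t1)%R) by (eapply Rle_trans; [apply Rmin_l|apply Rmin_l]).
  assert (Tt2 : (tau <= t2)%R) by (eapply Rle_trans; [apply Rmin_l|apply Rmin_r]).
  assert (Ts : (tau <= s0 / 2)%R) by (eapply Rle_trans; [apply Rmin_r|apply Rmin_l]).
  assert (Tr : (tau <= r / 4)%R).
  { eapply Rle_trans; [apply Rmin_r|]. eapply Rle_trans; [apply Rmin_r|apply Rmin_l]. }
  assert (Tr1 : (tau <= r1 / 4)%R).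
  { eapply Rle_trans; [apply Rmin_r|]. eapply Rle_trans; [apply Rmin_r|apply Rmin_r]. }
  clearbody tau d.
  pose (t := RtoC tau).
  assert (Ct : Cmod t = tau) by (unfold t; rewrite Cmod_R, Rabs_pos_eq; lra).
  assert (Hz2 : forall z, (Cmod (z - ze)%C <= d)%R -> (1 / 2 <= Cmod z <= 2)%R).
  { intros z Hz. split.
    - assert (h : (Cmod ze <= Cmod z + Cmod (- (z - ze)))%R).
      { replace ze with (z + - (z - ze)) at 1 by ring. apply Cmod_triangle. }
      rewrite Cmod_opp in h. lra.
    - replace z with (ze + (z - ze)) by ring. eapply Rle_trans; [apply Cmod_triangle|]. lra. }
  assert (Htz : forall z, (Cmod z <= 2)%R -> (Cmod (t * z) <= s0)%R).
  { intros z Hz. rewrite Cmod_mult, Ct. nra. }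
  assert (Hg0 : forall z, (Cmod z <= 2)%R -> (Cmod (g (t * z) - g 0)%C <= 2 * Kg * tau)%R).
  { intros z Hz. eapply Rle_trans; [apply HgL; auto; rewrite Cmod_0; lra|].
    replace (t * z - 0) with (t * z) by ring. rewrite Cmod_mult, Ct.
    replace (2 * Kg * tau)%R with (Kg * (tau * 2))%R by ring.
    apply Rmult_le_compat_l; auto. apply Rmult_le_compat_l; lra. }
  assert (HM : forall z, (Cmod z <= 2)%R -> (Cmod (g (t * z)%C) <= M)%R).
  { intros z Hz. replace (g (t * z)) with (g 0 + (g (t * z) - g 0)) by ring.
    eapply Rle_trans; [apply Cmod_triangle|]. assert (h := Hg0 z Hz).
    assert (Kg * (2 * tau) <= Kg * s0)%R by (apply Rmult_le_compat_l; lra).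
    unfold M. lra. }
  clearbody M.
  destruct (approximate_linear_zero (F := fun z => z ^ m * g (t * z) - g t) (z0 := ze)
              (c := c) (d := d)) as [z [Hz Fz]]; auto.
  - intros z w Hz Hw.
    (* Three errors: the nonlinearity of the power, the distance of g(tz) from g(0), and the change
       of g between tz and tw. *)
    replace (z ^ m * g (t * z) - g t - (w ^ m * g (t * w) - g t) - c * (z - w))
      with ((z ^ m - w ^ m - l * (z - w)) * g (t * z)
            + l * (z - w) * (g (t * z) - g 0) + w ^ m * (g (t * z) - g (t * w)))
      by (unfold c; ring).
    destruct (Hz2 z Hz) as [z1 z2]. destruct (Hz2 w Hw) as [w1 w2].
    assert (Pa := Cmod_ge_0 (z - w)). set (a := Cmod (z - w)) in *.
    assert (H1 : (Cmod ((z ^ m - w ^ m - l * (z - w)) * g (t * z)%C) <= Cmod c / 4 * a)%R).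
    { rewrite Cmod_mult. apply Rle_trans with (Kp * (2 * d) * a * M)%R.
      - apply Rmult_le_compat; try apply Cmod_ge_0; auto.
        eapply Rle_trans; [apply Hp; lra|]. fold a.
        apply Rmult_le_compat_r; auto. apply Rmult_le_compat_l; lra.
      - replace (Kp * (2 * d) * a * M)%R with (2 * Kp * M * d * a)%R by ring.
        apply Rmult_le_compat_r; auto. eapply Rle_trans; [|exact Hd1].
        apply Rmult_le_compat_l; auto. apply Rmult_le_pos; lra. }
    assert (H2 : (Cmod (l * (z - w) * (g (t * z)%C - g 0)) <= Cmod l * (2 * Kg) * tau * a)%R).
    { rewrite !Cmod_mult. fold a.
      replace (Cmod l * (2 * Kg) * tau * a)%R with (Cmod l * a * (2 * Kg * tau))%R by ring.
      apply Rmult_le_compat_l; auto. now apply Rmult_le_pos. }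
    assert (H3 : (Cmod (w ^ m * (g (t * z)%C - g (t * w)%C)) <= 2 ^ m * Kg * tau * a)%R).
    { rewrite Cmod_mult, Cmod_pow. rewrite !Rmult_assoc.
      apply Rmult_le_compat; try apply Cmod_ge_0; [apply pow_le, Cmod_ge_0| |].
      - apply pow_incr. split; [apply Cmod_ge_0|auto].
      - eapply Rle_trans; [apply HgL; auto|].
        replace (t * z - t * w) with (t * (z - w)) by ring. rewrite Cmod_mult, Ct. fold a. lra. }
    assert (H4 : ((Cmod l * (2 * Kg) + 2 ^ m * Kg) * tau * a <= Cmod c / 4 * a)%R).
    { apply Rmult_le_compat_r; auto. eapply Rle_trans; [|exact Ht1].
      apply Rmult_le_compat_l; auto. nra. }
    eapply Rle_trans; [apply Cmod_triangle|].
    eapply Rle_trans; [apply Rplus_le_compat_r, Cmod_triangle|]. lra.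
  - rewrite Z1, Cmult_1_l.
    assert (Hze : (Cmod (ze - 1)%C <= 2)%R).
    { eapply Rle_trans; [apply Cmod_triangle|]. rewrite Cmod_opp, Cmod_1, Z3. lra. }
    eapply Rle_trans; [apply HgL; [apply Htz; lra|lra]|].
    replace (t * ze - t) with (t * (ze - 1)) by ring. rewrite Cmod_mult, Ct.
    eapply Rle_trans; [|exact Ht2].
    replace (2 * Kg * t2)%R with (Kg * (t2 * 2))%R by ring.
    apply Rmult_le_compat_l; auto. apply Rmult_le_compat; lra.
  - destruct (Hz2 z Hz) as [z1 z2].
    exists (t * z), t. rewrite Cmod_mult, Ct. repeat split; try nra.
    + intros E.
      assert (t0 : t <> 0) by (apply Cmod_gt_0; lra).
      assert (Ez : z = 1).
      { transitivity (/ t * (t * z)); [field; auto|]. rewrite E. field; auto. }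
      rewrite Ez in Hz. replace (1 - ze) with (- (ze - 1)) in Hz by ring.
      rewrite Cmod_opp in Hz. lra.
    + rewrite !Hf.
      * rewrite Cpow_mult_l. replace (g t) with (z ^ m * g (t * z)); [ring|].
        transitivity (z ^ m * g (t * z) - g t + g t); [ring|rewrite Fz; ring].
      * lra.
      * rewrite Cmod_mult, Ct. nra.
Qed.

(** After subtraction of f(0), the germ is either zero, where any two points do, or of order at
    least 2: order 1 would make the derivative at 0 the nonzero cofactor. *)
Lemma not_injective_of_critical (f : C -> C) (r : R) :
  hol f -> C_derive f 0 = 0 -> (0 < r)%R ->
  exists s t, (0 < Cmod s < r)%R /\ (0 < Cmod t < r)%R /\ s <> t /\ f s = f t.
Proof.
  intros Hf D0 r0.
  pose (h := fun t => f t + - f 0).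
  assert (Hh : hol h) by (apply hol_plus; auto using hol_const).
  assert (Dh : C_derive h 0 = 0).
  { unfold h. rewrite (near_0 (derive_plus Hf (hol_const (- f 0)))), D0, derive_const. ring. }
  assert (R1 : exists s t, (0 < Cmod s < r)%R /\ (0 < Cmod t < r)%R /\ s <> t /\ h s = h t).
  { destruct (order_cases Hh) as [Z|[m Hm]].
    - apply near_iff in Z. destruct Z as [r1 [r10 Z]].
      pose (u := Rmin r r1). assert (u0 : (0 < u)%R) by now apply Rmin_glb_lt.
      assert (u1 : (u <= r)%R) by apply Rmin_l. assert (u2 : (u <= r1)%R) by apply Rmin_r.
      clearbody u.
      exists (RtoC (u / 2)%R), (RtoC (u / 3)%R). rewrite !Cmod_R, !Rabs_pos_eq by lra.
      repeat split; try lra.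
      + intros E. apply RtoC_inj in E. lra.
      + rewrite !Z; auto; rewrite Cmod_R, Rabs_pos_eq; lra.
    - apply (not_injective_of_order Hm); auto.
      assert (m0 : (0 < m)%nat) by (apply (has_order_pos Hm); unfold h; ring).
      destruct m as [|[|m]]; [lia| |lia]. exfalso.
      destruct Hm as [g [Hg [G0 E]]]. apply G0.
      assert (E1 : D1 (fun t => t ^ 1 * g t) 0 = D1 h 0) by exact (near_0 (derive_ext Hh E)).
      rewrite Dh in E1.
      assert (Hp : hol (fun t => t ^ 1)) by apply hol_pow, hol_id.
      rewrite (near_0 (derive_mult Hp Hg)) in E1.
      replace (C_derive (fun t => t ^ 1) 0) with (1 : C) in E1.
      + transitivity (1 * g 0 + 0 ^ 1 * C_derive g 0); [simpl; ring|exact E1].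
      + symmetry. apply cdiff_derive.
        replace (1 : C) with (1 * 1 + 0 * 0) by ring.
        exact (cdiff_mult (cdiff_id 0) (cdiff_const 1 0)). }
  destruct R1 as [s [t [Hs [Ht [Hst E]]]]]. exists s, t. repeat split; try tauto.
  transitivity (h s + f 0); [unfold h; ring|]. rewrite E. unfold h; ring.
Qed.

(** * Uniqueness of the osculating circle *)

Lemma A_finite_nonzero (x y : C -> C) : A_finite x y -> ~ (zero_germ x /\ zero_germ y).
Proof.
  intros [r [r0 [H _]]] [Zx Zy].
  destruct (proj1 (near_iff _) (near_and Zx Zy)) as [r1 [r10 Z]].
  pose (u := Rmin r r1). assert (u0 : (0 < u)%R) by now apply Rmin_glb_lt.
  assert (u1 : (u <= r)%R) by apply Rmin_l. assert (u2 : (u <= r1)%R) by apply Rmin_r.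
  clearbody u.
  assert (E : RtoC (u / 2)%R = RtoC (u / 3)%R).
  { apply H.
    - rewrite Cmod_R, Rabs_pos_eq; lra.
    - rewrite Cmod_R, Rabs_pos_eq; lra.
    - rewrite (proj1 (Z (RtoC (u / 2)%R) (ltac:(rewrite Cmod_R, Rabs_pos_eq; lra)))).
      now rewrite (proj1 (Z (RtoC (u / 3)%R) (ltac:(rewrite Cmod_R, Rabs_pos_eq; lra)))).
    - rewrite (proj2 (Z (RtoC (u / 2)%R) (ltac:(rewrite Cmod_R, Rabs_pos_eq; lra)))).
      now rewrite (proj2 (Z (RtoC (u / 3)%R) (ltac:(rewrite Cmod_R, Rabs_pos_eq; lra)))). }
  apply RtoC_inj in E. lra.
Qed.

Lemma A_finite_swap (x y : C -> C) : A_finite x y -> A_finite y x.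
Proof.
  intros [r [r0 [H1 H2]]]. exists r. repeat split; auto.
  intros t Ht [Ey Ex]. apply (H2 t Ht). auto.
Qed.

Lemma zero_germ_scal (c : C) (f g : C -> C) :
  c <> 0 -> near (fun t => c * f t = g t) -> zero_germ g -> zero_germ f.
Proof.
  intros Hc E H. refine (near_imp _ (near_and E H)). intros t [E1 E2].
  transitivity (/ c * (c * f t)); [field; auto|]. rewrite E1, E2. ring.
Qed.

Lemma zero_germ_lincomb (a b : C) (f g : C -> C) :
  zero_germ f -> zero_germ g -> zero_germ (lincomb a b f g).
Proof.
  intros Hf Hg. refine (near_imp _ (near_and Hf Hg)). intros t [E1 E2].
  unfold lincomb. rewrite E1, E2. ring.
Qed.

(** On a line with b^2 + c^2 <> 0, x and y are multiples of s = -cx + by, and the circle becomes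
    s(As + k) = 0. One factor vanishes identically; if it is the second, s(0) = 0 gives k = 0 and
    again s = 0. Then x and y are both zero. *)
Lemma line_and_circle (x y : C -> C) (b c A al be : C) :
  hol x -> hol y -> x 0 = 0 -> y 0 = 0 -> ~ (zero_germ x /\ zero_germ y) ->
  A <> 0 -> zero_germ (lincomb b c x y) -> zero_germ (pencil A al be x y) ->
  b ^ 2 + c ^ 2 = 0.
Proof.
  intros Hx Hy X0 Y0 H HA Hl Hp. apply NNPP. intros HK.
  pose (s := lincomb (- c) b x y). assert (Hs : hol s) by now apply hol_lincomb.
  assert (S0 : s 0 = 0) by (unfold s, lincomb; rewrite X0, Y0; ring).
  assert (Ex : near (fun t => (b ^ 2 + c ^ 2) * x t = - c * s t)).
  { refine (near_imp _ Hl). intros t E. unfold s, lincomb in *.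
    transitivity (b * (b * x t + c * y t) + - c * (- c * x t + b * y t)); [ring|rewrite E; ring]. }
  assert (Ey : near (fun t => (b ^ 2 + c ^ 2) * y t = b * s t)).
  { refine (near_imp _ Hl). intros t E. unfold s, lincomb in *.
    transitivity (c * (b * x t + c * y t) + b * (- c * x t + b * y t)); [ring|rewrite E; ring]. }
  assert (Zs : zero_germ s).
  { pose (k := be * b - al * c).
    assert (Hk : hol (fun t => A * s t + k)) by (apply hol_plus; auto using hol_scal, hol_const).
    assert (P : zero_germ (fun t => s t * (A * s t + k))).
    { apply zero_germ_scal with (c := b ^ 2 + c ^ 2)
        (g := fun t => (b ^ 2 + c ^ 2) ^ 2 * pencil A al be x y t); auto.
      - refine (near_imp _ (near_and Ex Ey)). intros t [E1 E2].
        transitivity (A * (((b ^ 2 + c ^ 2) * x t) * ((b ^ 2 + c ^ 2) * x t)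
            + ((b ^ 2 + c ^ 2) * y t) * ((b ^ 2 + c ^ 2) * y t))
            + (b ^ 2 + c ^ 2) * (al * ((b ^ 2 + c ^ 2) * x t) + be * ((b ^ 2 + c ^ 2) * y t))).
        + rewrite E1, E2. unfold k. ring.
        + unfold pencil, lincomb, sqnorm. ring.
      - refine (near_imp _ Hp). intros t ->. ring. }
    destruct (zero_germ_domain Hs Hk P) as [|Z]; auto.
    assert (k0 : k = 0).
    { apply near_0 in Z. rewrite S0 in Z. rewrite <- Z. ring. }
    apply zero_germ_scal with (c := A) (g := fun t => A * s t + k); auto.
    apply near_all; intros t; rewrite k0; ring. }
  apply H. split.
  - apply (zero_germ_scal HK Ex). refine (near_imp _ Zs). intros t ->; ring.
  - apply (zero_germ_scal HK Ey). refine (near_imp _ Zs). intros t ->; ring.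
Qed.

Lemma isotropic_of_zero (x y : C -> C) (b c A al be : C) :
  hol x -> hol y -> x 0 = 0 -> y 0 = 0 -> ~ (zero_germ x /\ zero_germ y) ->
  ~ (b = 0 /\ c = 0) -> A <> 0 ->
  zero_germ (lincomb b c x y) -> zero_germ (pencil A al be x y) -> in_isotropic_line x y.
Proof.
  intros Hx Hy X0 Y0 H Hbc HA Hl Hp. exists b, c. split; auto. split; auto.
  exact (line_and_circle Hx Hy X0 Y0 H HA Hl Hp).
Qed.

(** The vanishing of the 2x2 minors means rank one; the factor is the ratio at the first nonzero
    coefficient of [G], and it is nonzero because [H] is. *)
Lemma proportional_circles (G H : circle_or_line) :
  cA G * cB H = cA H * cB G -> cA G * cC H = cA H * cC G -> cB G * cC H = cB H * cC G ->
  same_curve G H.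
Proof.
  intros E1 E2 E3. destruct G as [A B D nG], H as [A' B' D' nH]. unfold same_curve. simpl in *.
  destruct (Ceq_dec A 0) as [EA|EA].
  - subst A.
    destruct (Ceq_dec B 0) as [EB|EB].
    + subst B. assert (ED : D <> 0) by tauto.
      assert (A0 : A' = 0).
      { transitivity (A' * D / D); [field; auto|]. rewrite <- E2. field; auto. }
      assert (B0 : B' = 0).
      { transitivity (B' * D / D); [field; auto|]. rewrite <- E3. field; auto. }
      exists (D' / D). subst. repeat split; try (field; auto).
      intros E. apply nH. repeat split; auto.
      transitivity (D' / D * D); [field; auto|rewrite E; ring].
    + assert (A0 : A' = 0).
      { transitivity (A' * B / B); [field; auto|]. rewrite <- E1. field; auto. }
      exists (B' / B). repeat split.
      * intros E. apply nH.
        assert (B0 : B' = 0) by (transitivity (B' / B * B); [field; auto|rewrite E; ring]).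
        repeat split; auto.
        transitivity (B * D' / B); [field; auto|]. rewrite E3, B0. field; auto.
      * rewrite A0; ring.
      * field; auto.
      * transitivity (B * D' / B); [field; auto|]. rewrite E3. field; auto.
  - exists (A' / A). repeat split.
    + intros E. apply nH.
      assert (A0 : A' = 0) by (transitivity (A' / A * A); [field; auto|rewrite E; ring]).
      repeat split; auto.
      * transitivity (A * B' / A); [field; auto|]. rewrite E1, A0. field; auto.
      * transitivity (A * D' / A); [field; auto|]. rewrite E2, A0. field; auto.
    + field; auto.
    + transitivity (A * B' / A); [field; auto|]. rewrite E1. field; auto.
    + transitivity (A * D' / A); [field; auto|]. rewrite E2. field; auto.
Qed.

(** Eliminating x^2 + y^2 gives a linear form bx + cy vanishing on the curve. If it is nontrivial,
    [G] or [H] is a circle and the line is isotropic. If it is trivial, two minors vanish; the third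
    does too, or else [G] and [H] are independent lines and the curve is constant. *)
Lemma zero_pencils (x y : C -> C) (G H : circle_or_line) :
  hol x -> hol y -> x 0 = 0 -> y 0 = 0 -> ~ (zero_germ x /\ zero_germ y) ->
  ~ in_isotropic_line x y ->
  zero_germ (pencil (cA G) (2 * cB G) (2 * cC G) x y) ->
  zero_germ (pencil (cA H) (2 * cB H) (2 * cC H) x y) -> same_curve G H.
Proof.
  intros Hx Hy X0 Y0 N NI ZG ZH.
  assert (n2 : (2 : C) <> 0) by (intros E; apply RtoC_inj in E; lra).
  pose (b := cA G * cB H - cA H * cB G). pose (c := cA G * cC H - cA H * cC G).
  assert (ZL : zero_germ (lincomb b c x y)).
  { apply zero_germ_scal with (c := RtoC 2)
      (g := lincomb (cA G) (- cA H) (pencil (cA H) (2 * cB H) (2 * cC H) x y)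
                              (pencil (cA G) (2 * cB G) (2 * cC G) x y)); auto.
    - apply near_all. intros t. unfold b, c, pencil, lincomb. ring.
    - now apply zero_germ_lincomb. }
  destruct (classic (b = 0 /\ c = 0)) as [[Eb Ec]|Hbc].
  - assert (E1 : cA G * cB H = cA H * cB G).
    { transitivity (b + cA H * cB G); [unfold b; ring|rewrite Eb; ring]. }
    assert (E2 : cA G * cC H = cA H * cC G).
    { transitivity (c + cA H * cC G); [unfold c; ring|rewrite Ec; ring]. }
    apply proportional_circles; auto.
    pose (det := cB G * cC H - cB H * cC G).
    destruct (Ceq_dec det 0) as [E|E].
    { transitivity (det + cB H * cC G); [unfold det; ring|rewrite E; ring]. }
    destruct (Ceq_dec (cA G) 0) as [A0|A0]; [destruct (Ceq_dec (cA H) 0) as [A1|A1]|].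
    + exfalso. apply N.
      assert (n2d : 2 * det <> 0) by now apply Cmult_neq_0.
      split.
      * apply zero_germ_scal with (c := 2 * det)
          (g := lincomb (cC H) (- cC G) (pencil (cA G) (2 * cB G) (2 * cC G) x y)
                              (pencil (cA H) (2 * cB H) (2 * cC H) x y)); auto.
        -- apply near_all. intros t. unfold det, pencil, lincomb. rewrite A0, A1. ring.
        -- now apply zero_germ_lincomb.
      * apply zero_germ_scal with (c := 2 * det)
          (g := lincomb (- cB H) (cB G) (pencil (cA G) (2 * cB G) (2 * cC G) x y)
                              (pencil (cA H) (2 * cB H) (2 * cC H) x y)); auto.
        -- apply near_all. intros t. unfold det, pencil, lincomb. rewrite A0, A1. ring.
        -- now apply zero_germ_lincomb.
    + assert (B0 : cB G = 0).
      { transitivity (cA H * cB G / cA H); [field; auto|]. rewrite <- E1, A0. field; auto. }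
      assert (D0 : cC G = 0).
      { transitivity (cA H * cC G / cA H); [field; auto|]. rewrite <- E2, A0. field; auto. }
      rewrite B0, D0. ring.
    + transitivity (cB G * (cA G * cC H) / cA G); [field; auto|]. rewrite E2.
      transitivity (cA H * cB G * cC G / cA G); [field; auto|]. rewrite <- E1. field; auto.
  - exfalso. apply NI. destruct (Ceq_dec (cA G) 0) as [A0|A0].
    + destruct (Ceq_dec (cA H) 0) as [A1|A1].
      * exfalso. apply Hbc. unfold b, c. rewrite A0, A1. split; ring.
      * exact (isotropic_of_zero Hx Hy X0 Y0 N Hbc A1 ZL ZH).
    + exact (isotropic_of_zero Hx Hy X0 Y0 N Hbc A0 ZL ZG).
Qed.

Lemma osculating_unique (x y : C -> C) (G H : circle_or_line) :
  hol x -> hol y -> x 0 = 0 -> y 0 = 0 -> ~ (zero_germ x /\ zero_germ y) ->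
  ~ in_isotropic_line x y -> osculating x y G -> osculating x y H -> same_curve G H.
Proof.
  intros Hx Hy X0 Y0 N NI OG OH.
  assert (E := Rbar_le_antisym _ _ (OH G) (OG H)).
  rewrite !contact_pencil in E by auto.
  assert (PG := hol_pencil (cA G) (2 * cB G) (2 * cC G) Hx Hy).
  assert (PH := hol_pencil (cA H) (2 * cB H) (2 * cC H) Hx Hy).
  destruct (order_cases PG) as [ZG|[n Hn]].
  - apply (zero_pencils Hx Hy X0 Y0 N NI ZG).
    apply ord_zero_iff; auto. rewrite <- E. now apply ord_zero.
  - rewrite (ord_has_order Hn) in E.
    destruct (reduce_order Hn PH (eq_sym E)) as [c Hc].
    pose (K := fun h => @CircleOrLine (cA H + c * cA G) (cB H + c * cB G) (cC H + c * cC G) h).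
    (* The combination of higher contact is a legitimate circle or line unless all its coefficients
       vanish, and that exception is proportionality with factor -c. *)
    destruct (classic (cA H + c * cA G = 0 /\ cB H + c * cB G = 0 /\ cC H + c * cC G = 0))
      as [[EA [EB EC]]|h].
    + assert (Solve : forall p q, q + c * p = 0 -> q = - c * p).
      { intros p q h. transitivity (q + c * p - c * p); [ring|rewrite h; ring]. }
      exists (- c). repeat split; try now apply Solve.
      intros c0. apply (c_nonzero (c := H)).
      rewrite (Solve _ _ EA), (Solve _ _ EB), (Solve _ _ EC), c0. repeat split; ring.
    + exfalso. assert (B := OG (K h)). rewrite !contact_pencil in B by auto.
      rewrite (ord_has_order Hn) in B.
      apply (Rbar_le_not_lt _ _ B).
      rewrite (ord_eqfun (g := fun t => pencil (cA H) (2 * cB H) (2 * cC H) x y t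
          + c * pencil (cA G) (2 * cB G) (2 * cC G) x y t)); auto.
      * now apply hol_pencil.
      * intros t. unfold K, pencil, lincomb. simpl. ring.
Qed.

(** * A singular A-finite germ lies on no circle or line *)

Lemma hol_small (f : C -> C) (e : R) : hol f -> f 0 = 0 -> (0 < e)%R ->
  near (fun t => Cmod (f t) < e)%R.
Proof.
  intros Hf F0 e0. destruct (hol_lipschitz Hf) as [s [K [s0 [K0 H]]]].
  destruct (@mult_small K (e / 2)) as [d [d0 Hd]]; [auto|lra|].
  apply near_iff. exists (Rmin s d). split; [now apply Rmin_glb_lt|]. intros t Ht.
  assert (t1 : (Cmod t < s)%R) by (eapply Rlt_le_trans; [exact Ht|apply Rmin_l]).
  assert (t2 : (Cmod t < d)%R) by (eapply Rlt_le_trans; [exact Ht|apply Rmin_r]).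
  assert (h := H t 0 (Rlt_le _ _ t1)). rewrite Cmod_0, F0 in h. specialize (h (Rlt_le _ _ s0)).
  replace (f t - 0) with (f t) in h by ring. replace (t - 0) with t in h by ring.
  assert (K * Cmod t <= K * d)%R by (apply Rmult_le_compat_l; lra). lra.
Qed.

(* A circle of the pencil with a nonzero x-coefficient is transverse to the lines
   y = const, so along it y determines x; but y has a critical point. *)
Lemma singular_not_on_graph (x y : C -> C) (A al be : C) :
  hol x -> hol y -> x 0 = 0 -> A_finite x y -> C_derive y 0 = 0 -> al <> 0 ->
  ~ zero_germ (pencil A al be x y).
Proof.
  intros Hx Hy X0 [r [r0 [Hinj _]]] Dy Hal Z.
  assert (a0 : (0 < Cmod al)%R) by now apply Cmod_gt_0.
  assert (Hs : near (fun t => Cmod (A * x t) < Cmod al / 2)%R).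
  { apply (@hol_small (fun t => A * x t)); [now apply hol_scal| |lra]. rewrite X0; ring. }
  destruct (proj1 (near_iff _) (near_and Z Hs)) as [r1 [r10 H]].
  destruct (not_injective_of_critical Hy Dy (r := Rmin r r1)) as [s [t [Ps [Pt [Hst E]]]]];
    [now apply Rmin_glb_lt|].
  assert (L1 := Rmin_l r r1). assert (L2 := Rmin_r r r1).
  destruct (H s) as [Zs Ss]; [lra|]. destruct (H t) as [Zt St]; [lra|].
  apply Hst, Hinj; auto; try lra.
  unfold pencil, lincomb, sqnorm in Zs, Zt. rewrite E in Zs.
  (* The two equations at equal y are subtracted; the second factor cannot vanish, since |Ax| <
     |al|/2 at both points. *)
  assert (M : (x s - x t) * (A * x s + A * x t + al) = 0).
  { transitivity ((A * (x s * x s + y t * y t) + 1 * (al * x s + be * y t))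
       - (A * (x t * x t + y t * y t) + 1 * (al * x t + be * y t))); [ring|].
    rewrite Zs, Zt. ring. }
  destruct (Ceq_dec (x s - x t) 0) as [E0|E0].
  - transitivity (x s - x t + x t); [ring|rewrite E0; ring].
  - exfalso. refine (Cmult_neq_0 _ _ E0 _ M). intros E1.
    assert (h : (Cmod al <= Cmod (A * x s) + Cmod (A * x t))%R).
    { rewrite <- (Cmod_opp al). eapply Rle_trans; [|apply Cmod_triangle].
      right. f_equal. transitivity (A * x s + A * x t + al - al); [rewrite E1|]; ring. }
    lra.
Qed.

Lemma pencil_swap (x y : C -> C) (A al be : C) :
  zero_germ (pencil A al be x y) -> zero_germ (pencil A be al y x).
Proof.
  apply zero_ext. apply near_all. intros t. unfold pencil, lincomb, sqnorm. ring.
Qed.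

(** With a nonzero linear coefficient, [singular_not_on_graph] applies, possibly after exchanging x
    and y. Otherwise the curve is x^2 + y^2 = 0, which splits into two isotropic lines, each covered
    by the same lemma with A = 0. *)
Lemma singular_contact_finite (x y : C -> C) (A al be : C) :
  hol x -> hol y -> x 0 = 0 -> y 0 = 0 -> A_finite x y -> singular_germ x y ->
  ~ (A = 0 /\ al = 0 /\ be = 0) -> ~ zero_germ (pencil A al be x y).
Proof.
  intros Hx Hy X0 Y0 Hfin [Sx Sy] Hn Z.
  destruct (Ceq_dec al 0) as [Eal|Hal];
    [|exact (singular_not_on_graph Hx Hy X0 Hfin Sy Hal Z)].
  destruct (Ceq_dec be 0) as [Ebe|Hbe];
    [|exact (singular_not_on_graph Hy Hx Y0 (A_finite_swap Hfin) Sx Hbe (pencil_swap Z))].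
  subst. assert (HA : A <> 0) by tauto.
  assert (L : forall c, zero_germ (fun t => x t + c * y t) -> False).
  { intros c Zc. apply (singular_not_on_graph (A := 0) (al := 1) (be := c) Hx Hy X0 Hfin Sy C1_nz).
    refine (zero_ext _ Zc). apply near_all. intros t. unfold pencil, lincomb. ring. }
  destruct (@zero_germ_domain (fun t => x t + Ci * y t) (fun t => x t + - Ci * y t)) as [H|H].
  - apply hol_plus; auto using hol_scal.
  - apply hol_plus; auto using hol_scal.
  - apply zero_germ_scal with (c := A) (g := pencil A 0 0 x y); auto.
    apply near_all. intros t. unfold pencil, lincomb, sqnorm.
    replace (A * ((x t + Ci * y t) * (x t + - Ci * y t)))
      with (A * (x t * x t - Ci ^ 2 * (y t * y t))) by ring.
    replace (Ci ^ 2) with (- (1) : C); [ring|].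
    unfold Ci, Cpow, Cmult, Copp, RtoC; simpl; f_equal; ring.
  - exact (L _ H).
  - exact (L _ H).
Qed.

(** * Normal forms *)

Lemma normal_form_x (x y : C -> C) (m n : nat) (a : C) :
  normal_form x y m n a -> has_order x m.
Proof.
  intros [_ [_ [Ex _]]]. exists (fun _ => 1). repeat split; [apply hol_const|apply C1_nz|].
  refine (near_imp _ Ex). intros t ->. ring.
Qed.

Lemma normal_form_y (x y : C -> C) (m n : nat) (a : C) : hol y ->
  normal_form x y m n a ->
  exists g, hol g /\ g 0 = a /\ near (fun t => y t = t ^ n * g t).
Proof.
  intros Hy [_ [_ [_ Ey]]]. apply vanishes_of_ord in Ey.
  - destruct Ey as [p [Hp E]]. exists (fun t => a + t * p t). repeat split.
    + apply hol_plus; [apply hol_const|]. apply hol_mult; auto using hol_id.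
    + ring.
    + refine (near_imp _ E). intros t Et.
      transitivity (y t - a * t ^ n + a * t ^ n); [ring|]. rewrite Et, Cpow_add_r. ring.
  - apply hol_minus; auto. apply hol_scal, hol_pow, hol_id.
Qed.

Lemma normal_form_order_y (x y : C -> C) (m n : nat) (a : C) : hol y ->
  normal_form x y m n a -> has_order y n.
Proof.
  intros Hy H. destruct (normal_form_y Hy H) as [g [Hg [G0 E]]].
  exists g. repeat split; auto. rewrite G0. apply H.
Qed.

Lemma derive_ratio_small (x y : C -> C) (m n : nat) (e : R) :
  has_order x m -> has_order y n -> (0 < m < n)%nat -> (0 < e)%R ->
  near (fun t => t <> 0 ->
    (0 < Cmod (C_derive x t))%R /\ (Cmod (C_derive y t) <= e * Cmod (C_derive x t))%R).
Proof.
  intros [g [Hg [G0 Nx]]] [h [Hh [_ Ny]]] Hmn e0.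
  destruct (euler Hg Nx) as [p [Hp [P0 Np]]]. destruct (euler Hh Ny) as [q [Hq [_ Nq]]].
  assert (Pnz : p 0 <> 0).
  { rewrite P0. apply Cmult_neq_0; auto. apply INR_C_nz. lia. }
  assert (C0 : (0 < Cmod (p 0))%R) by now apply Cmod_gt_0.
  assert (S1 : near (fun t => Cmod (p t - p 0) < Cmod (p 0) / 2)%R).
  { apply (@hol_small (fun t => p t - p 0)); [|ring|lra]. apply hol_minus; auto using hol_const. }
  assert (S2 : near (fun t => Cmod (t * q t) < Rmin 1 (e * (Cmod (p 0) / 2)))%R).
  { apply (@hol_small (fun t => t * q t)); [|ring|].
    - apply hol_mult; auto using hol_id.
    - apply Rmin_glb_lt; nra. }
  assert (S3 : near (fun t => Cmod t < 1)%R) by (apply (hol_small hol_id); [auto|lra]).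
  refine (near_imp _ (near_and (near_and Np Nq) (near_and S1 (near_and S2 S3)))).
  intros t [[E1 E2] [L1 [L2 L3]]] t0.
  assert (T0 : (0 < Cmod t)%R) by now apply Cmod_gt_0.
  apply (f_equal Cmod) in E1. apply (f_equal Cmod) in E2.
  rewrite !Cmod_mult, Cmod_pow in E1, E2. rewrite Cmod_mult in L2.
  assert (L4 : (Cmod (p 0) / 2 < Cmod (p t))%R).
  { assert (h1 : (Cmod (p 0) <= Cmod (p t) + Cmod (- (p t - p 0)))%R).
    { replace (p 0) with (p t + - (p t - p 0)) at 1 by ring. apply Cmod_triangle. }
    rewrite Cmod_opp in h1. lra. }
  assert (Tm : (0 < Cmod t ^ m)%R) by now apply pow_lt.
  assert (L5 : (Cmod t * Cmod (q t) <= e * Cmod (p t))%R).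
  { assert (h1 := Rmin_r 1 (e * (Cmod (p 0) / 2))).
    assert (e * (Cmod (p 0) / 2) <= e * Cmod (p t))%R by (apply Rmult_le_compat_l; lra). lra. }
  (* Of t^(n - m), one factor t stays with q to make it small; the others have modulus at most 1. *)
  assert (L6 : (Cmod t ^ n * Cmod (q t) <= Cmod t ^ m * (Cmod t * Cmod (q t)))%R).
  { replace n with (m + 1 + (n - m - 1))%nat by lia.
    rewrite !pow_add, pow_1.
    assert (0 <= Cmod t ^ (n - m - 1) <= 1)%R.
    { split; [apply pow_le; lra|]. rewrite <- (pow1 (n - m - 1)). apply pow_incr. lra. }
    assert (0 <= Cmod t ^ m * (Cmod t * Cmod (q t)))%R.
    { apply Rmult_le_pos; [lra|]. apply Rmult_le_pos; [lra|apply Cmod_ge_0]. }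
    nra. }
  split.
  - apply Rmult_lt_reg_l with (Cmod t); auto. rewrite Rmult_0_r, E1. nra.
  - apply Rmult_le_reg_l with (Cmod t); auto. rewrite E2.
    replace (Cmod t * (e * Cmod (C_derive x t)))%R with (e * (Cmod t * Cmod (C_derive x t)))%R
      by ring.
    rewrite E1. eapply Rle_trans; [exact L6|].
    replace (e * (Cmod t ^ m * Cmod (p t)))%R with (Cmod t ^ m * (e * Cmod (p t)))%R by ring.
    apply Rmult_le_compat_l; lra.
Qed.

(** As y'/x' tends to 0, the normalised form of [is_tangent_line] tends to |B|, which vanishes only
    for the line y = 0. *)
Lemma tangent_line_iff (x y : C -> C) (m n : nat) (G : circle_or_line) :
  has_order x m -> has_order y n -> (0 < m < n)%nat ->
  (is_tangent_line x y G <-> is_line G /\ cB G = 0).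
Proof.
  intros Hx Hy Hmn.
  split; intros [HG H]; split; auto.
  - apply NNPP. intros Hb. assert (b0 : (0 < Cmod (cB G))%R) by now apply Cmod_gt_0.
    assert (c0 := Cmod_ge_0 (cC G)).
    assert (e0 : (0 < Cmod (cB G) / 4)%R) by lra.
    assert (H' := proj1 (filterlim_locally _ _) H (mkposreal _ e0)).
    destruct (@mult_small (Cmod (cC G)) (Cmod (cB G) / 4)) as [d [d0 Hd]]; [auto|lra|].
    (* The bound 1 gives |x'| + |y'| <= 2|x'| in the denominator and [d] gives |Cy'| <= |Bx'|/4; a
       quotient below |B|/4 would then yield |Bx'| < (3/4)|Bx'|. *)
    assert (R0 := derive_ratio_small Hx Hy Hmn (e := Rmin 1 d) ltac:(apply Rmin_glb_lt; lra)).
    destruct (near_punctured R0 H') as [t [t0 [H1 H2]]].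
    destruct (H1 t0) as [X0 HY]. specialize (H2 t0).
    change (Rabs (Cmod (cB G * C_derive x t + cC G * C_derive y t)%C /
        (Cmod (C_derive x t) + Cmod (C_derive y t)) - 0) < Cmod (cB G) / 4)%R in H2.
    assert (Y0 := Cmod_ge_0 (C_derive y t)).
    set (X := Cmod (C_derive x t)) in *. set (Y := Cmod (C_derive y t)) in *.
    assert (m1 := Rmin_l 1 d). assert (m2 := Rmin_r 1 d).
    assert (Y1 : (Y <= X)%R) by nra. assert (Y2 : (Y <= d * X)%R) by nra.
    rewrite Rminus_0_r in H2. apply Rabs_lt_between in H2. destruct H2 as [_ H2].
    apply Rmult_lt_compat_r with (r := (X + Y)%R) in H2; [|lra].
    set (W := Cmod (cB G * C_derive x t + cC G * C_derive y t)) in *.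
    replace (W / (X + Y) * (X + Y))%R with W in H2 by (field; lra).
    assert (h : (Cmod (cB G) * X <= W + Cmod (cC G) * Y)%R).
    { unfold X, Y, W. rewrite <- !Cmod_mult, <- (Cmod_opp (cC G * C_derive y t)).
      eapply Rle_trans; [|apply Cmod_triangle]. right. f_equal. ring. }
    assert (h2 : (Cmod (cC G) * Y <= Cmod (cB G) / 4 * X)%R).
    { apply Rle_trans with (Cmod (cC G) * (d * X))%R; [now apply Rmult_le_compat_l|].
      rewrite <- Rmult_assoc. apply Rmult_le_compat_r; lra. }
    nra.
  - apply filterlim_locally. intros eps.
    assert (c0 := Cmod_ge_0 (cC G)).
    destruct (@mult_small (Cmod (cC G)) (eps / 2)) as [d [d0 Hd]];
      [auto|assert (h := cond_pos eps); lra|].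
    assert (R0 := derive_ratio_small Hx Hy Hmn d0).
    refine (near_imp _ R0). intros t Ht t0. destruct (Ht t0) as [X0 HY].
    change (Rabs (Cmod (cB G * C_derive x t + cC G * C_derive y t)%C /
        (Cmod (C_derive x t) + Cmod (C_derive y t)) - 0) < eps)%R.
    rewrite H, Cmult_0_l, Cplus_0_l, Cmod_mult, Rminus_0_r.
    assert (Y0 := Cmod_ge_0 (C_derive y t)).
    set (X := Cmod (C_derive x t)) in *. set (Y := Cmod (C_derive y t)) in *.
    assert (h := cond_pos eps).
    rewrite Rabs_pos_eq by (apply Rdiv_le_0_compat; [now apply Rmult_le_pos|lra]).
    apply Rmult_lt_reg_r with (X + Y)%R; [lra|].
    replace (Cmod (cC G) * Y / (X + Y) * (X + Y))%R with (Cmod (cC G) * Y)%R by (field; lra).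
    assert (h2 : (Cmod (cC G) * Y <= eps / 2 * X)%R).
    { apply Rle_trans with (Cmod (cC G) * (d * X))%R; [now apply Rmult_le_compat_l|].
      rewrite <- Rmult_assoc. apply Rmult_le_compat_r; lra. }
    nra.
Qed.

Lemma tangent_line_contact (x y : C -> C) (m n : nat) :
  has_order x m -> has_order y n -> (0 < m < n)%nat ->
  exists G, is_tangent_line x y G /\
    (forall H, is_tangent_line x y H -> same_curve G H) /\
    contact x y G = Finite (INR n).
Proof.
  intros Hx Hy Hmn. assert (Fx := has_order_hol Hx). assert (Fy := has_order_hol Hy).
  destruct (@line_exists 0 1 x y Fx Fy) as [G [LG [BG [CG EG]]]].
  { intros [_ E]. exact (C1_nz E). }
  exists G. split; [|split].
  - now apply (tangent_line_iff G Hx Hy Hmn).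
  - intros H HH. apply (tangent_line_iff H Hx Hy Hmn) in HH. destruct HH as [LH BH].
    red in LG, LH. apply proportional_circles; rewrite ?LG, ?LH, ?BG, ?BH; ring.
  - rewrite EG, <- (ord_has_order Hy). apply ord_eqfun; [now apply hol_lincomb|].
    intros t. unfold lincomb. ring.
Qed.

(** The circle x^2 + y^2 = 0 has contact 2m, because y^2 has order 2n > 2m; the orders m, n, 2m are
    already distinct. *)
Lemma V_ord_generic (x y : C -> C) (m n : nat) :
  has_order x m -> has_order y n -> (0 < m < n)%nat -> n <> (2 * m)%nat ->
  V_ord x y = Finite (3 * INR m + INR n - 6).
Proof.
  intros Hx Hy Hmn Hn. assert (Fx := has_order_hol Hx). assert (Fy := has_order_hol Hy).
  rewrite (V_ord_pencil 0 0 Fx Fy C1_nz).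
  assert (Hw : has_order (pencil 1 0 0 x y) (m + m)).
  { apply (has_order_eqfun (f := fun t => x t * x t + y t * y t)).
    - intros t. unfold pencil, lincomb, sqnorm. ring.
    - apply has_order_plus; [now apply has_order_mult|].
      apply (has_order_vanishes (has_order_mult Hy Hy)). lia. }
  rewrite (ord_W3 Hx Hy Hw) by lia. rewrite plus_INR. f_equal. ring.
Qed.

(** Here y and x^2 + y^2 both have order 2m, and y - a(x^2 + y^2) = -t^(2m) z cancels the leading
    terms. The orders m, 2m, 2m + ord z sum to 3m + n + ord z, and [ord_W3] subtracts 6, not the 3
    of the English formula: for (t, t^2), v = -24t has order 1 = 3 + 2 + 2 - 6. *)
Lemma V_ord_resonant (x y y1 : C -> C) (m : nat) (a : C) :
  has_order x m -> has_order y (2 * m) -> (0 < m)%nat -> a <> 0 ->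
  near (fun t => x t = t ^ m) -> second_factor y m a y1 ->
  V_ord x y = Rbar_minus (Rbar_plus (Finite (3 * INR m + INR (2 * m)))
      (ord (fun t => a * t ^ (2 * m) * (a + y1 t) ^ 2 - y1 t))) (Finite 6).
Proof.
  intros Hx Hy m0 Ha Ex [Hy1 [Y10 Ey]].
  assert (Fx := has_order_hol Hx). assert (Fy := has_order_hol Hy).
  assert (Ha' : - a <> 0).
  { intros E. apply Ha. transitivity (- - a); [ring|rewrite E; ring]. }
  rewrite (V_ord_pencil 0 1 Fx Fy Ha').
  set (z := fun t => a * t ^ (2 * m) * (a + y1 t) ^ 2 - y1 t).
  assert (Hz : hol z).
  { apply hol_minus; auto. apply hol_mult.
    - apply hol_scal, hol_pow, hol_id.
    - apply hol_pow, hol_plus; auto using hol_const. }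
  assert (Ew : near (fun t => t ^ (2 * m) * (-1 * z t) = pencil (- a) 0 1 x y t)).
  { refine (near_imp _ (near_and Ex Ey)). intros t [E1 E2].
    unfold pencil, lincomb, sqnorm, z. rewrite E1, E2.
    replace (2 * m)%nat with (m + m)%nat by lia. rewrite Cpow_add_r. ring. }
  destruct (order_cases Hz) as [Z|[k Hk]].
  - rewrite (ord_zero Z). apply ord_zero, W3_zero_3. refine (zero_ext Ew _).
    refine (near_imp _ Z). intros t ->. ring.
  (* Needed for 2m + k to differ from the order 2m of y; it comes from y1(0) = 0 and m > 0. *)
  - assert (k0 : (0 < k)%nat).
    { apply (has_order_pos Hk). unfold z. rewrite Y10.
      destruct m; [lia|]. simpl. ring. }
    assert (Hw : has_order (pencil (- a) 0 1 x y) (2 * m + k)).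
    { apply (has_order_ext Ew). apply has_order_mult.
      - exists (fun _ => 1). repeat split; [apply hol_const|apply C1_nz|].
        apply near_all. intros t; ring.
      - apply has_order_scal; auto. intros E; apply RtoC_inj in E; lra. }
    rewrite (ord_has_order Hk), (ord_W3 Hx Hy Hw) by lia.
    cbn [Rbar_plus Rbar_plus' Rbar_minus Rbar_opp]. rewrite !plus_INR, !mult_INR. simpl. f_equal. ring.
Qed.
Unset Implicit Arguments.

Theorem theorem3p5 (x y : C -> C)
    (hg : curve_germ x y) (hfin : A_finite x y) :
  (* (1) *)
  ((exists G, osculating x y G /\
      (~ in_isotropic_line x y ->
       forall H, osculating x y H -> same_curve G H)) /\
   (singular_germ x y ->
    forall G, osculating x y G -> contact x y G <> p_infty)) /\
  (* (2) *)
  (forall (m n : nat) (a : C), normal_form x y m n a ->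
     (exists G, is_tangent_line x y G /\
        (forall H, is_tangent_line x y H -> same_curve G H) /\
        contact x y G = Finite (INR n)) /\
     I_ord x y = Finite (INR m + INR n - 3)) /\
  (* (3) *)
  (exists lam : Rbar, is_lambda x y lam /\
     V_ord x y = Rbar_minus (Rbar_plus (I_ord x y) lam) (Finite 3)) /\
  (* (4) *)
  (forall (m n : nat) (a : C), normal_form x y m n a ->
     (n <> (2 * m)%nat ->
      V_ord x y = Finite (3 * INR m + INR n - 6)) /\
     (n = (2 * m)%nat ->
      (exists y1, second_factor y m a y1) /\
      (forall y1, second_factor y m a y1 ->
         V_ord x y =
         Rbar_minus
           (Rbar_plus (Finite (3 * INR m + INR n))
              (ord (fun t => a * t ^ (2 * m) * (a + y1 t) ^ 2 - y1 t)))
           (Finite 6)))).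
Proof.
  destruct hg as [Hx [Hy [X0 Y0]]].
  assert (N := A_finite_nonzero hfin).
  split; [split|split; [|split]].
  - destruct (osculating_exists Hx Hy N) as [G HG]. exists G. split; auto.
    intros NI H HH. exact (osculating_unique Hx Hy X0 Y0 N NI HG HH).
  - intros Hs G _. rewrite contact_pencil by auto. intros E.
    apply ord_zero_iff in E; [|now apply hol_pencil].
    refine (singular_contact_finite Hx Hy X0 Y0 hfin Hs _ E).
    intros [EA [EB EC]]. apply (c_nonzero (c := G)). auto using double_nz.
  - intros m n a Hn. assert (Ox := normal_form_x Hn).
    assert (Oy := normal_form_order_y Hy Hn). destruct Hn as [Hmn _].
    split; [now apply (tangent_line_contact Ox Oy)|].
    (* [i_germ x y] and [W2 x y] are convertible. *)
    apply (ord_W2 Ox Oy); lia.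
  - now apply V_I_lambda.
  - intros m n a Hn. assert (Ox := normal_form_x Hn).
    assert (Oy := normal_form_order_y Hy Hn).
    destruct (normal_form_y Hy Hn) as [g [Hg [G0 Eg]]].
    destruct Hn as [Hmn [Ha [Ex _]]]. split.
    + now apply V_ord_generic.
    + intros ->. split.
      (* [g] is the cofactor of t^n in y, with g(0) = a. *)
      * exists (fun t => g t - a). repeat split.
        -- apply hol_minus; auto using hol_const.
        -- rewrite G0. ring.
        -- refine (near_imp _ Eg). intros t ->. ring.
      * intros y1 Hy1. apply (V_ord_resonant Ox Oy); auto. lia.
Qed.
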